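(* Let $\mathbf G$ be a compact metric graph with $\mathbf V_{int}\neq\emptyset$ and $\mathbf V_{end}\neq\emptyset$. For each $p>1$, let $u_p$ be a least energy solution of the Dirichlet--Kirchhoff Lane--Emden problem on $\mathbf G$. Then $$M\subset \mathbf G\setminus \mathbf V .$$ Moreover, for every sequence $\{p_n\}$ with $p_n\to\infty$, there exist a subsequence, still denoted by $\{p_n\}$, and a point $a_*\in M$ such that $$u_{p_n}\longrightarrow \frac{G(\cdot,a_* )}{G(a_*,a_* )}$$ strongly in $H^1_0(\mathbf G)$ and uniformly on $\mathbf G$.
   Context: Graphs. $\mathbf G=\mathbf G(\mathbf V,\mathbf E)$ is a graph with vertex set $\mathbf V$ and edge set $\mathbf E$; it is connected, has finitely many edges, contains no loops, and no vertex has degree $2$. It is a compact metric graph: each edge $\mathbf e$ is identified with an interval $[0,l(\mathbf e)]$ with $0<l(\mathbf e)<\infty$. $\mathbf V_{int}$ is the set of vertices of degree $\ge 3$, $\mathbf V_{end}$ the set of vertices of degree $1$, and $\mathbf V=\mathbf V_{int}\sqcup\mathbf V_{end}$. Write $\mathbf e\succ\mathbf v$ if $\mathbf e$ is incident to $\mathbf v$. Function spaces. For a function $u$ on $\mathbf G$, $u^{(\mathbf e)}$ is its restriction to $\mathbf e$, $\nabla=\frac{d}{dx}$ and $\Delta=\frac{d^2}{dx^2}$ on each edge, and $\int_{\mathbf G}=\sum_{\mathbf e}\int_0^{l(\mathbf e)}$. $H^1(\mathbf G)$ is the space of continuous functions $u$ on $\mathbf G$ with $u^{(\mathbf e)}\in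 H^1(\mathbf e)$ for all $\mathbf e$, with norm $\|u\|_{H^1(\mathbf G)}^2=\int_{\mathbf G}(|\nabla u|^2+u^2)dx$; $H^1_0(\mathbf G)=\{u\in H^1(\mathbf G): u(\mathbf v)=0\ \forall \mathbf v\in\mathbf V_{end}\}$. Green function. For $y\in\mathbf G\setminus\mathbf V_{end}$, the Dirichlet--Kirchhoff Green function $G(\cdot,y)$ is the unique element of $H_0^1(\mathbf G)$ with $\int_{\mathbf G}\nabla_xG(x,y)\nabla\varphi(x)\,dx=\varphi(y)$ for all $\varphi\in H^1_0(\mathbf G)$; for $y\in\mathbf V_{end}$, $G(\cdot,y)=0$. Set $M=\{a\in\mathbf G: G(a,a)=\max_{x\in\mathbf G}G(x,x)\}$. Least energy solutions. Let $J_p(u)=\frac12\int_{\mathbf G}|\nabla u|^2dx-\frac1{p+1}\int_{\mathbf G}|u|^{p+1}dx$ and $\sigma_p=\inf_{u\in H^1_0(\mathbf G)\setminus\{0\}}\sup_{t>0}J_p(tu)$. The Dirichlet--Kirchhoff Lane--Emden problem is: $u$ continuous on $\mathbf G$; $-\Delta u^{(\mathbf e)}=(u^{(\mathbf e)})^p$ and $u^{(\mathbf e)}>0$ in (the interior of) each edge; $\sum_{\mathbf e\succ\mathbf v}\partial u^{(\mathbf e)}(\mathbf v)=0$ for each $\mathbf v\in\mathbf V_{int}$, where $\partial u^{(\mathbf e)}(\mathbf v)$ is the outward derivative at $\mathbf v$ along $\mathbf e$ (derivative in the direction pointing from $\mathbf v$ into $\mathbf e$); $u(\mathbf v)=0$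 for each $\mathbf v\in\mathbf V_{end}$. A least energy solution is a (positive) solution $u_p$ of this problem with $J_p(u_p)=\sigma_p$; one exists for each $p>1$. *)

(* Defs.v *)
(* MathComp-Analysis *)
From HB Require Import structures.
From mathcomp Require Export all_boot all_order all_algebra.
From mathcomp Require Export all_classical all_reals all_analysis.
Export Order.TTheory GRing.Theory Num.Theory numFieldNormedType.Exports.

Set Implicit Arguments.
Unset Strict Implicit.
Unset Printing Implicit Defensive.

(* The identification of an edge e with [0, len e] orients it from [src e]
   (coordinate 0) to [tgt e] (coordinate len e).  Parallel edges are allowed. *)
Record combinatorial_graph := CombinatorialGraph {
  vert : finType;
  edge : finType;
  src : edge -> vert;
  tgt : edge -> vert }.

Definition incident (G : combinatorial_graph) (e : edge G) (v : vert G) : bool :=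
  (src e == v) || (tgt e == v).

(* In the absence of loops this is the usual degree. *)
Definition degree (G : combinatorial_graph) (v : vert G) : nat :=
  #|[set e : edge G | incident e v]|.

Definition adjacent (G : combinatorial_graph) : rel (vert G) :=
  [rel v w | [exists e : edge G, incident e v && incident e w]].

Record metric_graph (R : realType) := MetricGraph {
  graph_of :> combinatorial_graph;
  len : edge graph_of -> R;
  len_gt0 : forall e, (0 < len e)%R;
  loopless : forall e : edge graph_of, src e != tgt e;
  connected_graph : forall v w : vert graph_of, connect (@adjacent graph_of) v w;
  degree_neq2 : forall v : vert graph_of, degree v != 2%N }.

Definition V_int (G : combinatorial_graph) : {set vert G} :=
  [set v | (3 <= degree v)%N].
Definition V_end (G : combinatorial_graph) : {set vert G} :=
  [set v | degree v == 1%N].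

Local Open Scope classical_set_scope.
Local Open Scope ring_scope.

(* The points of the metric graph: the disjoint union of the closed edges with
   endpoints glued, i.e. the vertices together with the open edges. *)
Inductive point (R : realType) (G : metric_graph R) :=
  | Vtx of vert G
  | Inner (e : edge G) (x : R) of 0 < x < len e.

Arguments Vtx {R G}.
Arguments Inner {R G}.

Section Functions.
Context {R : realType} {G : metric_graph R}.
Local Notation mu := (@lebesgue_measure R).
Implicit Types (u v : point G -> R) (e : edge G).

(* The parametrization [0, len e] -> G of the closed edge e; coordinates outside
   [0, len e] are sent to the nearest endpoint. *)
Definition chart e (x : R) : point G :=
  match pselect (0 < x < len e) with
  | left h => Inner e x h
  | right _ => Vtx (if x <= 0 then src e else tgt e)
  end.

Definition restr u e : R -> R := fun x => u (chart e x).

(* G carries the quotient topology of the disjoint union of its closed edges. *)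
Definition continuous_on_graph u : Prop :=
  forall e, {within `[0, len e], continuous (restr u e)}.

Definition graph_integral (F : edge G -> R -> R) : R :=
  \sum_(e : edge G) \int[mu]_(x in `[0, len e]) F e x.

Definition square_integrable (l : R) (f : R -> R) : Prop :=
  measurable_fun `[0, l] f /\
  mu.-integrable `[0, l] (fun x => (f x ^+ 2)%:E).

(* C^1 functions with compact support in the open interval (0, l). *)
Definition test_function (l : R) (phi : R -> R) : Prop :=
  [/\ forall x, derivable phi x 1,
      continuous (derive1 phi) &
      exists a b : R, [/\ 0 < a, b < l &
        forall x, ~~ (a <= x <= b) -> phi x = 0]].

Definition is_weak_derivative (l : R) (f g : R -> R) : Prop :=
  square_integrable l g /\
  forall phi, test_function l phi ->
    \int[mu]_(x in `[0, l]) (f x * derive1 phi x) =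
    - \int[mu]_(x in `[0, l]) (g x * phi x).

Definition H1_interval (l : R) (f : R -> R) : Prop :=
  square_integrable l f /\ exists g, is_weak_derivative l f g.

(* A chosen representative; for f in H^1(0, l) it is unique up to a null set. *)
Definition weak_derivative (l : R) (f : R -> R) : R -> R :=
  xget (fun=> 0) [set g | is_weak_derivative l f g].

Definition grad u e : R -> R := weak_derivative (len e) (restr u e).

Definition H1 : set (point G -> R) :=
  [set u | continuous_on_graph u /\ forall e, H1_interval (len e) (restr u e)].

Definition H10 : set (point G -> R) :=
  [set u | H1 u /\ forall w, w \in V_end G -> u (Vtx w) = 0].

Definition H1_norm u : R :=
  Num.sqrt (graph_integral (fun e x => grad u e x ^+ 2 + restr u e x ^+ 2)).

Definition cvg_H10 (u_ : nat -> point G -> R) u : Prop :=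
  [/\ forall n, H10 (u_ n), H10 u &
      H1_norm (fun x => u_ n x - u x) @[n --> \oo] --> (0 : R)].

Definition cvg_uniformly (u_ : nat -> point G -> R) u : Prop :=
  forall eps : R, 0 < eps ->
    \forall n \near \oo, forall x, `|u_ n x - u x| < eps.

Definition is_end (y : point G) : bool :=
  if y is Vtx w then w \in V_end G else false.

Definition is_green (y : point G) (g : point G -> R) : Prop :=
  H10 g /\ forall phi, H10 phi ->
    graph_integral (fun e x => grad g e x * grad phi e x) = phi y.

Definition green (x y : point G) : R :=
  if is_end y then 0 else xget (fun=> 0) [set g | is_green y g] x.

Definition green_max : set (point G) :=
  [set a | forall x, green x x <= green a a].

Definition energy (p : R) u : R :=
  2^-1 * graph_integral (fun e x => `|grad u e x| ^+ 2) -
  (p + 1)^-1 * graph_integral (fun e x => `|restr u e x| `^ (p + 1)).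

Definition least_energy (p : R) : \bar R :=
  ereal_inf
    [set ereal_sup [set (energy p (fun x => t * u x))%:E | t in [set t | 0 < t]]
    | u in [set u | H10 u /\ exists x, u x != 0]].

(* The point at distance t from w along e, for e incident to w. *)
Definition along e (w : vert G) (t : R) : point G :=
  chart e (if src e == w then t else len e - t).

Definition outward_quotient u e (w : vert G) : R -> R :=
  fun t => (u (along e w t) - u (Vtx w)) / t.

Definition outward_derivative u e (w : vert G) : R :=
  lim (outward_quotient u e w t @[t --> 0^'+]).

Definition kirchhoff u (w : vert G) : Prop :=
  (forall e, incident e w -> cvg (outward_quotient u e w t @[t --> 0^'+])) /\
  \sum_(e : edge G | incident e w) outward_derivative u e w = 0.

Definition lane_emden_solution (p : R) u : Prop :=
  [/\ continuous_on_graph u,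
      forall e x, 0 < x < len e ->
        [/\ 0 < restr u e x,
            derivable (restr u e) x 1,
            derivable (derive1 (restr u e)) x 1 &
            - derive1 (derive1 (restr u e)) x = restr u e x `^ p],
      forall w, w \in V_int G -> kirchhoff u w &
      forall w, w \in V_end G -> u (Vtx w) = 0].

Definition least_energy_solution (p : R) u : Prop :=
  lane_emden_solution p u /\ (energy p u)%:E = least_energy p.

End Functions.

Arguments green {R} G.
Arguments green_max {R} G.

(* Main.v *)
Require Import Defs.
From HB Require Import structures.
From mathcomp Require Import ring lra measurable_realfun.

(** Write D(u, v) for the integral of u' v' over the graph G.  Evaluation at a point
    y is continuous on H^1_0(G) and is represented in D by G(., y), so
    Cauchy--Schwarz gives w(y)^2 <= G(y, y) D(w, w) ([green_bound]): the points of M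
    are those where a function can reach height 1 at the least Dirichlet energy,
    namely 1 / G(y, y), and G(., y) / G(y, y) is the function that does it.

    In dimension one these objects are explicit.  Restricted to functions that are
    affine on the edges, D is the energy of an electrical network; the Green function
    of a vertex solves a finite linear system, injective since every vertex is
    connected to V_end ([network_green]), and that of an inner point is obtained by
    interpolating between the ends of its edge and adding a tent
    ([point_representer]).  The analytic input is that a continuous function is the
    integral of its weak derivative ([FTC_weak]) and that the latter is unique almost
    everywhere ([weak_derivative_unique]).

    M contains no vertex.  On V_end the Green function vanishes.  At any other vertex
    a, moving away by y along an edge e changes G(x, x) by (1 + 2 s_e) y + O(y^2),
    where s_e is the outward slope of G(., a) along e ([green_max_slope]).  These
    slopes add up to -1 ([sum_slope]), so the sum of the 1 + 2 s_e over the edges at a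
    is deg a - 2 > 0 (the degrees 1 and 2 being excluded, and 0 because the slopes do
    not add up to 0), and G(x, x) increases along one of them.

    Convergence.  Put A_p = D(u_p, u_p).  Multiplying the equation by u_p and using
    Kirchhoff's law, A_p is also the integral of u_p^(p + 1) ([lane_emden_nehari]), so
    J_p(u_p) = (1/2 - 1/(p + 1)) A_p.
    - Upper bound: comparing with the fibre through a multiple of G(., y) / G(y, y)
      that exceeds 1 around y gives limsup A_p <= 1 / G(y, y) for each y outside
      V_end ([energy_limsup]).
    - Lower bound: if m_p is the maximum of u_p and C the constant of the uniform
      Poincare inequality, then m_p^2 <= C A_p <= C |G| m_p^(p + 1), whence
      liminf m_p >= 1 ([near_peak]).
    - Along a subsequence the maximum points converge to some a; since the A_p are
      bounded, Hoelder continuity gives liminf u_p(a) >= 1 ([peak_limit]).  Then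
      1 <= G(a, a) liminf A_p <= G(a, a) / G(y, y) for all such y, that is, a is in
      M ([peak_limit_max]).
    - Expanding the square, D(u_p - w, u_p - w) for w = G(., a) / G(a, a) equals
      A_p - 2 u_p(a) / G(a, a) + 1 / G(a, a), whose limsup is at most 0; the Poincare
      inequality turns this into both convergences ([dirichlet_cvg]). *)

Set Implicit Arguments.
Unset Strict Implicit.
Unset Printing Implicit Defensive.

Local Open Scope classical_set_scope.
Local Open Scope ring_scope.

(** * Square integrable functions on an interval *)

Section SquareIntegrable.
Context {R : realType}.
Local Notation mu := (@lebesgue_measure R).
Implicit Types (f g h : R -> R) (l : R).

(** Domination by [f^2 + g^2]. *)
Lemma square_integrable_mul l f g :
  square_integrable l f -> square_integrable l g ->
  mu.-integrable `[0, l] (EFin \o (fun x => f x * g x)).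
Proof.
move=> [mf if2] [mg ig2].
apply: (@le_integrable _ _ _ mu _ _ _ (fun x => (f x ^+ 2 + g x ^+ 2)%:E)) => //.
- by apply/measurable_EFinP; exact: measurable_funM.
- move=> x _; rewrite lee_fin normrM -(real_normK (num_real (f x))).
  rewrite -(real_normK (num_real (g x))).
  rewrite [leRHS]ger0_norm ?addr_ge0 ?sqr_ge0//.
  have := sqr_ge0 (`|f x| - `|g x|); have := normr_ge0 (f x).
  have := normr_ge0 (g x); nra.
- apply: (@eq_integrable _ _ _ mu _ _ (fun x => ((f x ^+ 2)%:E + (g x ^+ 2)%:E)%E)) => //.
  exact: integrableD.
Qed.

Lemma bounded_square_integrable l f (M : R) :
  measurable_fun `[0, l] f -> (forall x : R, x \in `[0, l] -> `|f x| <= M) ->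
  square_integrable l f.
Proof.
move=> mf fM; split=> //.
apply: (@measurable_bounded_integrable _ _ _ mu (fun x => f x ^+ 2)) => //.
- exact: (compact_finite_measure (@segment_compact R 0 l)).
- exact: measurable_funX.
- exists (M ^+ 2); split; first exact: num_real.
  move=> y My x /= xl; apply: ltW; apply: le_lt_trans My.
  by rewrite normrX lerXn2r ?nnegrE//; [exact: le_trans (fM x xl)|exact: fM].
Qed.

Lemma continuous_square_integrable l f :
  {within `[0, l], continuous f} -> square_integrable l f.
Proof.
move=> cf; have mf : measurable_fun `[0, l] f.
  by apply: subspace_continuous_measurable_fun.
have /compact_bounded[M [Mr Mf]] := continuous_compact cf (@segment_compact R 0 l).
apply: (@bounded_square_integrable _ _ (`|M| + 1)) => // x xl.
apply: Mf; last by exists x.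
by rewrite ltr_pwDr// ler_norm.
Qed.

Lemma square_integrable_cst l (c : R) : square_integrable l (cst c).
Proof. by apply: (@bounded_square_integrable _ _ `|c|). Qed.

Lemma square_integrable_integrable l f : square_integrable l f ->
  mu.-integrable `[0, l] (EFin \o f).
Proof.
move=> fl; apply: eq_integrable (square_integrable_mul fl (square_integrable_cst l 1)) => //.
by move=> x _ /=; rewrite mulr1.
Qed.

Lemma square_integrableD l f g (c : R) :
  square_integrable l f -> square_integrable l g ->
  square_integrable l (fun x => f x + c * g x).
Proof.
move=> fl gl; split.
  by apply: measurable_funD; [exact: fl.1|apply: measurable_funM => //; exact: gl.1].
apply: (@eq_integrable _ _ _ mu _ _ (fun x => ((f x ^+ 2)%:E + ((2 * c)%:E * (f x * g x)%:E
    + (c ^+ 2)%:E * (g x ^+ 2)%:E))%E)) => //.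
  by move=> x _; rewrite -!EFinM -!EFinD; congr EFin; ring.
apply: integrableD => //; first exact: fl.2.
apply: integrableD => //; apply: integrableZl => //; last exact: gl.2.
exact: square_integrable_mul.
Qed.

Lemma RintegralDM l f g h (c : R) :
  square_integrable l f -> square_integrable l g -> square_integrable l h ->
  \int[mu]_(x in `[0, l]) ((f x + c * g x) * h x) =
  \int[mu]_(x in `[0, l]) (f x * h x) + c * \int[mu]_(x in `[0, l]) (g x * h x).
Proof.
move=> fl gl hl; under eq_Rintegral do rewrite mulrDl -mulrA.
rewrite RintegralD//; last 2 first.
- exact: square_integrable_mul.
- apply: (@eq_integrable _ _ _ mu _ _ (fun x => (c%:E * (g x * h x)%:E)%E)) => //.
  by apply: integrableZl => //; exact: square_integrable_mul.
by rewrite RintegralZl//; exact: square_integrable_mul.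
Qed.

Lemma square_integrable_indic l (A : set R) : measurable A -> square_integrable l \1_A.
Proof.
move=> mA; apply: (@bounded_square_integrable _ _ 1); first exact: measurable_indic.
by move=> z _; rewrite indicE; case: (_ \in _); rewrite ?normr1 ?normr0.
Qed.

Lemma Rintegral_mul_indic l (A : set R) h : A `<=` `[0, l] ->
  \int[mu]_(x in `[0, l]) (h x * \1_A x) = \int[mu]_(x in A) h x.
Proof.
move=> sub; rewrite -[in RHS](setIidr sub) Rintegral_mkcondr.
apply: eq_Rintegral => x _.
by rewrite patchE indicE; case: ifP => _; rewrite /= ?mulr1 ?mulr0.
Qed.

Lemma lebesgue_measure_bounded_itv (b1 b2 : bool) (x y : R) : x <= y ->
  lebesgue_measure [set` Interval (BSide b1 x) (BSide b2 y)] = (y - x)%:E.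
Proof.
rewrite lebesgue_measure_itv/= lte_fin le_eqVlt => /predU1P[->|->//].
by rewrite ltxx subrr.
Qed.

Lemma Rintegral_cst_itv (b1 b2 : bool) (x y c : R) : x <= y ->
  \int[mu]_(_ in [set` Interval (BSide b1 x) (BSide b2 y)]) c = c * (y - x).
Proof.
move=> xy; rewrite Rintegral_cst//; congr (_ * _).
exact: (congr1 fine (lebesgue_measure_bounded_itv b1 b2 xy)).
Qed.

End SquareIntegrable.

(** * Smooth steps *)

Section Ramp.
Context {R : realType}.
Implicit Types (x y : R).

Definition pos_sqr y : R := Num.max 0 y ^+ 2.

(** The square makes the corner of the positive part differentiable: at 0 the
    difference quotient is at most [|h|]. *)
Lemma is_derive_pos_sqr y : is_derive y 1 pos_sqr (2 * Num.max 0 y).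
Proof.
have [y0|y0|<-] := ltgtP 0 y.
- apply: (@near_eq_is_derive _ _ _ (fun x => x * x)).
    near=> z; rewrite /pos_sqr expr2 max_r// ltW//.
    by near: z; exact: lt_nbhsr.
  by apply: is_derive_eq; rewrite /GRing.scale/=; ring.
- apply: (@near_eq_is_derive _ _ _ (cst 0)).
    near=> z; rewrite /pos_sqr max_l ?expr0n// ltW//.
    by near: z; exact: lt_nbhsl.
  by apply: is_derive_eq; rewrite mulr0.
- rewrite mulr0.
  have h0 : (fun h : R => h^-1 *: ((pos_sqr \o shift 0) (h *: 1) - pos_sqr 0))
      h @[h --> 0^'] --> 0.
    apply/cvgrPdist_lt => e e0; near=> h.
    rewrite sub0r normrN /= /pos_sqr maxxx expr0n/= subr0 addr0 [h *: 1]mulr1.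
    have hn0 : h != 0 by near: h; exact: nbhs_dnbhs_neq.
    rewrite /GRing.scale/= normrM normfV ltr_pdivrMl ?normr_gt0//.
    have he : `|h| < e.
      near: h; apply: dnbhs0_lt => //.
    have hp : 0 < `|h| by rewrite normr_gt0.
    rewrite ger0_norm ?sqr_ge0//; case: (leP 0 h) => h0.
      by rewrite expr2 ger0_norm // in he hp *; nra.
    by rewrite expr0n/=; nra.
  split; last by apply/cvg_lim => //.
  by apply/cvg_ex; exists 0.
Unshelve. all: by end_near. Qed.

(** A [C^1] Heaviside function: three translates of the [C^1] function [pos_sqr],
    weighted so that their slopes cancel to the right of 1. *)
Definition ramp y : R := 2 * pos_sqr y - 4 * pos_sqr (y - 2^-1) + 2 * pos_sqr (y - 1).

(** The derivative of [ramp], a tent of mass 1 supported in [0, 1]. *)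
Definition hat y : R :=
  4 * Num.max 0 y - 8 * Num.max 0 (y - 2^-1) + 4 * Num.max 0 (y - 1).

Lemma is_derive_ramp y : is_derive y 1 ramp (hat y).
Proof.
have s c : is_derive y 1 (fun z => pos_sqr (z - c)) (2 * Num.max 0 (y - c)).
  have := @is_derive1_comp _ pos_sqr (fun z => z - c) y (2 * Num.max 0 (y - c)) 1.
  rewrite mulr1; apply.
  - exact: is_derive_pos_sqr.
  - by apply: is_derive_eq; rewrite subr0.
have s0 := is_derive_pos_sqr y.
rewrite /ramp.
by apply: is_derive_eq; rewrite /hat /GRing.scale/=; ring.
Qed.

Lemma ramp_le0 y : y <= 0 -> ramp y = 0.
Proof.
move=> y0; rewrite /ramp /pos_sqr !max_l ?expr0n/= ?mulr0 ?subrr ?addr0//; lra.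
Qed.

Lemma ramp_ge1 y : 1 <= y -> ramp y = 1.
Proof. by move=> y1; rewrite /ramp /pos_sqr !max_r; [field|lra..]. Qed.

Lemma ramp_itv y : 0 <= ramp y <= 1.
Proof.
rewrite /ramp /pos_sqr.
case: (leP 0 y) => ?; case: (leP 0 (y - 2^-1)) => ?; case: (leP 0 (y - 1)) => ?;
  rewrite ?expr0n /=; apply/andP; split; nra.
Qed.

Lemma hat_ge0 y : 0 <= hat y.
Proof.
rewrite /hat.
by case: (leP 0 y) => ?; case: (leP 0 (y - 2^-1)) => ?; case: (leP 0 (y - 1)) => ?; lra.
Qed.

Lemma hat_out y : ~~ (0 <= y <= 1) -> hat y = 0.
Proof.
rewrite /hat negb_and -!ltNge => /orP y01.
by case: (leP 0 y) => ?; case: (leP 0 (y - 2^-1)) => ?; case: (leP 0 (y - 1)) => ?;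
  case: y01 => ?; lra.
Qed.

Lemma hat_continuous : continuous hat.
Proof.
have m c : continuous (fun y : R => Num.max 0 (y - c)).
  move=> y; apply: (@continuous_max R R (cst 0) (fun y => y - c)).
    exact: cvg_cst.
  by apply: cvgB; [exact: cvg_id|exact: cvg_cst].
have m0 : continuous (fun y : R => Num.max 0 y).
  move=> y; apply: (@continuous_max R R (cst 0) id); [exact: cvg_cst|exact: cvg_id].
move=> y; apply: cvgD; first apply: cvgB.
- by apply: cvgM; [exact: cvg_cst|exact: m0].
- by apply: cvgM; [exact: cvg_cst|exact: m].
- by apply: cvgM; [exact: cvg_cst|exact: m].
Qed.

(** Differences of two such steps are [C^1] test functions approximating the
    indicator of an interval as [k] grows. *)
Definition step (k c x : R) : R := ramp (k * (x - c)).

Lemma is_derive_step k c x : is_derive x 1 (step k c) (k * hat (k * (x - c))).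
Proof.
rewrite mulrC.
apply: (@is_derive1_comp _ ramp (fun z => k * (z - c))); first exact: is_derive_ramp.
by apply: is_derive_eq; rewrite /GRing.scale/= ?subr0 ?mulr1 ?mulr0 ?addr0.
Qed.

Lemma step_derivative_continuous k c : continuous (fun x => k * hat (k * (x - c))).
Proof.
move=> x; apply: cvgM; first exact: cvg_cst.
apply: (@continuous_comp _ _ _ (fun x => k * (x - c)) hat); last exact: hat_continuous.
by apply: cvgM; [exact: cvg_cst|apply: cvgB; [exact: cvg_id|exact: cvg_cst]].
Qed.

End Ramp.

(** * Weak derivatives on an interval *)

Section WeakDerivative.
Context {R : realType}.
Local Notation mu := (@lebesgue_measure R).
Implicit Types (f g F : R -> R) (l a b c x : R).

Lemma is_derive_LRcontinuous F f a b : (forall x, is_derive x 1 F (f x)) ->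
  derivable_oo_LRcontinuous F a b.
Proof.
move=> dF; have cF x : {for x, continuous F}.
  by apply: differentiable_continuous; apply/derivable1_diffP; case: (dF x).
split; first by move=> x _; case: (dF x).
- by apply: cvg_at_right_filter; exact: cF.
- by apply: cvg_at_left_filter; exact: cF.
Qed.

Lemma Rintegral_FTC2 F f a b : a < b -> {within `[a, b], continuous f} ->
  derivable_oo_LRcontinuous F a b -> {in `]a, b[, derive1 F =1 f} ->
  \int[mu]_(x in `[a, b]) f x = F b - F a.
Proof. by move=> ab cf dF Ff; rewrite /Rintegral (continuous_FTC2 ab cf dF Ff). Qed.

Lemma step_before (k c x : R) : x <= c -> 0 <= k -> step k c x = 0.
Proof. by move=> xc k0; rewrite /step ramp_le0// mulr_ge0_le0// subr_le0. Qed.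

Lemma step_after (k c x : R) : 1 <= k * (x - c) -> step k c x = 1.
Proof. exact: ramp_ge1. Qed.

(** The derivative of [step n.+1%:R c] has mass 1, by the fundamental theorem of
    calculus, and is supported in [[c, c + 1 / n.+1]], where [f] is close to [f c]. *)
Lemma approximate_identity l f c : 0 < c < l -> {within `[0, l], continuous f} ->
  \int[mu]_(x in `[0, l]) (f x * (n.+1%:R * hat (n.+1%:R * (x - c)))) @[n --> \oo]
    --> f c.
Proof.
move=> /andP[c0 cl] cf; have l0 : 0 < l by exact: lt_trans cl.
have lc0 : 0 < l - c by rewrite subr_gt0.
have /(continuous_within_itvP _ l0)[cfi _ _] := cf.
have /cfi fc : c \in `]0, l[ by rewrite in_itv/= c0.
apply/cvgrPdist_le => e e0.
have /cvgrPdist_lt /(_ _ e0) [d /= d0 dfe] := fc.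
near=> n.
have k0 : 0 < n.+1%:R :> R by [].
have nd : n.+1%:R^-1 < d by near: n; exact: near_infty_natSinv_lt (PosNum d0).
have ncl : n.+1%:R^-1 < l - c.
  by near: n; exact: near_infty_natSinv_lt (PosNum lc0).
pose rho x := n.+1%:R * hat (n.+1%:R * (x - c)).
have rho0 x : 0 <= rho x by rewrite mulr_ge0// hat_ge0.
have crho : {within `[0, l], continuous rho}.
  by apply: continuous_subspaceT; exact: step_derivative_continuous.
have Irho : \int[mu]_(x in `[0, l]) rho x = 1.
  rewrite (@Rintegral_FTC2 (step n.+1%:R c))//.
  - rewrite step_after ?step_before ?subr0 ?(ltW c0)//.
    by rewrite mulrC -ler_pdivrMr// div1r ltW.
  - by apply: is_derive_LRcontinuous => x; exact: is_derive_step.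
  - move=> x _; rewrite derive1E.
    by have [_ ->] := is_derive_step n.+1%:R c x.
have sf := continuous_square_integrable cf.
have srho := continuous_square_integrable crho.
have sc := square_integrable_cst l (f c).
have -> : f c = \int[mu]_(x in `[0, l]) (f c * rho x).
  by rewrite RintegralZl ?Irho ?mulr1//; exact: square_integrable_integrable.
rewrite -RintegralB//; last 2 first.
- exact: (square_integrable_mul sc).
- exact: (square_integrable_mul sf).
have sfc : square_integrable l (fun x => f x + -1 * f c).
  by apply: (@square_integrableD _ _ f (cst (f c))).
have iD : mu.-integrable `[0, l] (EFin \o (fun x => f c * rho x - f x * rho x)).
  apply: eq_integrable (square_integrable_mul (square_integrableD (-1) sc sf) srho) => //.
  by move=> x _; congr EFin; rewrite /=; ring.
apply: le_trans (le_normr_Rintegral _ _) _ => //.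
have -> : e = \int[mu]_(x in `[0, l]) (e * rho x).
  by rewrite RintegralZl ?Irho ?mulr1//; exact: square_integrable_integrable.
apply: le_Rintegral => //.
- exact: integrable_norm.
- exact: (square_integrable_mul (square_integrable_cst l e)).
move=> x _; rewrite -mulrBl normrM (ger0_norm (rho0 x)).
have [xc|] := boolP (0 <= n.+1%:R * (x - c) <= 1); last first.
  by move=> /hat_out h; rewrite /rho h !mulr0.
apply: ler_wpM2r => //; apply/ltW/dfe => /=.
move: xc => /andP[]; rewrite pmulr_rge0// => xc.
rewrite -ler_pdivlMl// mulr1 => xn.
by rewrite distrC ger0_norm//; exact: le_lt_trans nd.
Unshelve. all: by end_near. Qed.

Lemma step_test_function l a b n : 0 < a -> a < b -> b + n.+1%:R^-1 < l ->
  test_function l (fun x => step n.+1%:R a x - step n.+1%:R b x).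
Proof.
move=> a0 ab bl; set k : R := n.+1%:R.
have k0 : 0 < k by [].
have dphi x : is_derive x 1 (fun x => step k a x - step k b x)
    (k * hat (k * (x - a)) - k * hat (k * (x - b))).
  by have h1 := is_derive_step k a x; have h2 := is_derive_step k b x;
     exact: is_deriveB.
split.
- by move=> x; case: (dphi x).
- rewrite [X in continuous X](_ : _ =
      fun x => k * hat (k * (x - a)) - k * hat (k * (x - b))); last first.
    by apply/funext => x; rewrite derive1E; case: (dphi x).
  by move=> x; apply: cvgB; exact: step_derivative_continuous.
- exists a, (b + k^-1); split => // x; rewrite negb_and -!ltNge => /orP[xa|xb].
    by rewrite !step_before ?subrr// ltW// (lt_trans xa).
  have kx : 1 <= k * (x - b) by rewrite mulrC -ler_pdivrMr// div1r lerBrDl ltW.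
  rewrite !step_after ?subrr//; apply: le_trans kx _.
  by rewrite ler_wpM2l ?ltW// ltrD2l ltrN2.
Qed.

(** Test against a difference of steps climbing at [a] and descending at [b]: on the
    side of [g] it tends to the indicator of [`]a, b]], by dominated convergence, and
    on the side of [f] its derivative is a difference of approximate identities. *)
Lemma FTC_weak_oo l f g a b : {within `[0, l], continuous f} ->
  is_weak_derivative l f g -> 0 < a -> a < b -> b < l ->
  \int[mu]_(x in `]a, b]) g x = f b - f a.
Proof.
move=> cf [sg fg] a0 ab bl.
have l0 : 0 < l by rewrite (lt_trans a0)// (lt_trans ab).
have ablE : `]a, b] `<=` `[0, l].
  by apply: subset_itvScc; rewrite bnd_simp ltW.
pose phi n x := step n.+1%:R a x - step n.+1%:R b x.
have cphi n : {within `[0, l], continuous (phi n)}.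
  apply: continuous_subspaceT => x; apply: differentiable_continuous.
  apply/derivable1_diffP; apply: derivableB.
    by case: (is_derive_step n.+1%:R a x).
  by case: (is_derive_step n.+1%:R b x).
have cvg1 : \int[mu]_(x in `[0, l]) (g x * phi n x) @[n --> \oo] -->
    \int[mu]_(x in `]a, b]) g x.
  have gi := square_integrable_integrable sg.
  have fin : (\int[mu]_(x in `]a, b]) (g x)%:E)%E \is a fin_num.
    by apply: integrable_fin_num => //; exact: integrableS gi.
  apply: fine_cvg; rewrite fineK//.
  rewrite -(setIidr ablE) integral_mkcondr.
  apply: (@dominated_cvg _ _ _ mu _ _ (fun n x => (g x * phi n x)%:E) _
      (fun x => `|g x|%:E)) => //.
  - move=> n; apply/measurable_EFinP; apply: measurable_funM; first exact: sg.1.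
    exact: (continuous_square_integrable (cphi n)).1.
  - move=> x /= xl; apply: cvg_near_cst; rewrite patchE.
    case: ifPn => [|].
      rewrite inE/= in_itv/= => /andP[ax xb].
      have xa0 : 0 < x - a by rewrite subr_gt0.
      near=> n; rewrite /phi step_after ?step_before ?subr0 ?mulr1//.
      rewrite mulrC -ler_pdivrMr// div1r ltW//.
      by near: n; exact: near_infty_natSinv_lt (PosNum xa0).
    rewrite notin_setE/= in_itv/= => /negP; rewrite negb_and -leNgt -ltNge.
    move=> /orP[xa|xb].
      near=> n; rewrite /phi !step_before ?subrr ?mulr0//.
      by rewrite (le_trans xa)// ltW.
    have xb0 : 0 < x - b by rewrite subr_gt0.
    near=> n.
    have kx : 1 <= n.+1%:R * (x - b).
      rewrite mulrC -ler_pdivrMr// div1r ltW//.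
      by near: n; exact: near_infty_natSinv_lt (PosNum xb0).
    rewrite /phi !step_after ?subrr ?mulr0//; apply: le_trans kx _.
    by apply: ler_wpM2l => //; rewrite lerD2l lerN2 ltW.
  - exact: integrable_norm.
  - move=> n x _; rewrite lee_fin normrM ler_piMr// ler_norml.
    have := ramp_itv (n.+1%:R * (x - a)); have := ramp_itv (n.+1%:R * (x - b)).
    by rewrite /phi /step => /andP[? ?] /andP[? ?]; apply/andP; split; lra.
have cvg2 : - (\int[mu]_(x in `[0, l]) (g x * phi n x)) @[n --> \oo] --> f a - f b.
  have lb0 : 0 < l - b by rewrite subr_gt0.
  have al : 0 < a < l by rewrite a0 (lt_trans ab).
  have bl' : 0 < b < l by rewrite (lt_trans a0).
  have h := cvgB (approximate_identity al cf) (approximate_identity bl' cf).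
  apply: cvg_trans (h _); apply: near_eq_cvg; near=> n; apply/esym.
  have bnl : b + n.+1%:R^-1 < l.
    rewrite -ltrBrDl; near: n; exact: near_infty_natSinv_lt (PosNum lb0).
  rewrite -(fg _ (step_test_function a0 ab bnl)).
  have sf := continuous_square_integrable cf.
  have srho c : square_integrable l (fun x => n.+1%:R * hat (n.+1%:R * (x - c))).
    by apply/continuous_square_integrable/continuous_subspaceT/step_derivative_continuous.
  transitivity (\int[mu]_(x in `[0, l]) (f x * (n.+1%:R * hat (n.+1%:R * (x - a)))) -
    \int[mu]_(x in `[0, l]) (f x * (n.+1%:R * hat (n.+1%:R * (x - b))))); last by [].
  rewrite -RintegralB//; [|exact: square_integrable_mul..].
  apply: eq_Rintegral => x _; rewrite -mulrBr derive1E.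
  have h1 := is_derive_step n.+1%:R a x; have h2 := is_derive_step n.+1%:R b x.
  by rewrite derive_val.
have : f a - f b = - \int[mu]_(x in `]a, b]) g x.
  by apply: (@cvg_unique _ (@Rhausdorff R) _ _ _ _ cvg2); exact: cvgN.
by lra.
Unshelve. all: by end_near. Qed.

(** Used to carry identities from the open interval to the end points. *)
Lemma constant_oo_cc (K : R -> R) a b (k : R) : a < b ->
  {within `[a, b], continuous K} -> (forall x, a < x < b -> K x = k) ->
  forall x, a <= x <= b -> K x = k.
Proof.
move=> ab /(continuous_within_itvP _ ab)[_ Ka Kb] Kk x /andP[].
rewrite le_eqVlt => /predU1P[<- _|ax].
  apply: (@cvg_unique _ (@Rhausdorff R) _ _ _ _ Ka).
  apply: cvg_near_cst; near=> z; apply: Kk; apply/andP; split; near: z.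
    exact: nbhs_right_gt.
  exact: nbhs_right_lt.
rewrite le_eqVlt => /predU1P[->|xb]; last by rewrite Kk// ax.
apply: (@cvg_unique _ (@Rhausdorff R) _ _ _ _ Kb).
apply: cvg_near_cst; near=> z; apply: Kk; apply/andP; split; near: z.
  exact: nbhs_left_gt.
exact: nbhs_left_lt.
Unshelve. all: by end_near. Qed.

(** At the end points no test function is available; there continuity of both sides
    in [x] extends the identity. *)
Lemma FTC_weak l f g x : 0 < l -> {within `[0, l], continuous f} ->
  is_weak_derivative l f g -> 0 <= x <= l ->
  \int[mu]_(t in `[0, x]) g t = f x - f 0.
Proof.
move=> l0 cf fg xl; have gi := square_integrable_integrable fg.1.
pose K y := f y - \int[mu]_(t in `[0, y]) g t.
have cK : {within `[0, l], continuous K}.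
  move=> y; apply: cvgB; first exact: cf.
  exact: (parameterized_integral_continuous (ltW l0) gi).
have KK y z : 0 < y -> y < z -> z < l -> K y = K z.
  move=> y0 yz zl; have := FTC_weak_oo cf fg y0 yz zl.
  rewrite -(@Rintegral_itvB _ _ (BLeft 0)) ?bnd_simp ?(ltW y0) ?(ltW yz)//.
    by rewrite /K; lra.
  by apply: integrableS gi => //; apply: subset_itvl; rewrite bnd_simp ltW.
have Koo y : 0 < y < l -> K y = K (l / 2).
  move=> /andP[y0 yl]; have [yl2|yl2|->//] := ltgtP y (l / 2).
    by apply: KK => //; lra.
  by apply/esym/KK => //; lra.
have Kx := constant_oo_cc l0 cK Koo xl.
have := constant_oo_cc l0 cK Koo (_ : 0 <= 0 <= l).
rewrite lexx ltW// -Kx => /(_ isT).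
by rewrite /K set_itv1 Rintegral_set1 => /eqP; lra.
Qed.

(** The difference of two weak derivatives of [f] is a weak derivative of 0, so its
    primitive vanishes identically, and Lebesgue differentiation applies. *)
Lemma weak_derivative_unique l f g1 g2 : 0 < l ->
  is_weak_derivative l f g1 -> is_weak_derivative l f g2 ->
  ae_eq mu [set` `[0, l]] (EFin \o g1) (EFin \o g2).
Proof.
move=> l0 [s1 fg1] [s2 fg2].
pose h x := g1 x + -1 * g2 x.
have sh : square_integrable l h by exact: square_integrableD.
have h0 : is_weak_derivative l (cst 0) h.
  split=> // phi tphi.
  under eq_Rintegral do rewrite mul0r.
  have sphi : square_integrable l phi.
    apply/continuous_square_integrable/continuous_subspaceT => x.
    by apply: differentiable_continuous; apply/derivable1_diffP; case: tphi.
  rewrite /h RintegralDM// mulN1r.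
  have := fg1 _ tphi; rewrite fg2// => /oppr_inj ->.
  by rewrite subrr oppr0 Rintegral_cst// mul0r.
have c0 : {within `[0, l], continuous (cst 0 : R -> R)}.
  by apply: continuous_subspaceT => x; exact: cvg_cst.
pose h0l := h \_ `[0, l].
have intloc : mu.-integrable setT (EFin \o h0l).
  rewrite -restrict_EFin; apply/integrable_restrict => //=; rewrite setTI.
  exact: square_integrable_integrable.
(* The base point -1 leaves all of [0, l] in the domain of differentiation. *)
have := @FTC1 _ h0l (BLeft (-1)).
have int y : mu.-integrable [set` Interval (BLeft (-1)) (BRight y)] (EFin \o h0l).
  exact: integrableS intloc.
have loc : locally_integrable [set: R] h0l.
  apply: integrable_locally => //; exact: square_integrable_integrable.
move=> /(_ int loc) /=.
have F0 y : \int[mu]_(t in [set` Interval (BLeft (-1)) (BRight y)]) h0l t = 0.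
  rewrite -Rintegral_mkcondr; have [y0|y0] := ltP y 0.
    rewrite (_ : _ `&` _ = set0) ?Rintegral_set0//.
    by apply/seteqP; split=> z //=; rewrite !in_itv/= => -[/andP[_ ?] /andP[? _]]; lra.
  rewrite (_ : _ `&` _ = `[0, Num.min y l]%classic); last first.
    apply/seteqP; split=> z /=; rewrite !in_itv/= le_min.
      by move=> [/andP[_ ->] /andP[-> ->]].
    by move=> /and3P[z0 -> ->]; rewrite z0 !andbT; lra.
  by rewrite (FTC_weak l0 c0 h0) ?subrr// le_min y0 ltW//= ge_min lexx orbT.
apply: filterS; first exact: (ae_filter_ringOfSetsType mu).
move=> x H; rewrite /= in_itv/= => xl.
have [] := H _; first by rewrite lte_fin; case/andP: xl => ? _; lra.
move=> _; rewrite (_ : (fun _ => _) = cst 0); last by apply/funext.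
have xm : x \in [set` `[0, l]] by rewrite inE/= in_itv.
rewrite derive1_cst /h0l patchE xm /h => /esym h0x.
by congr EFin; lra.
Qed.

Lemma weak_derivativeP l f : H1_interval l f ->
  is_weak_derivative l f (weak_derivative l f).
Proof. by move=> [_ [g fg]]; rewrite /weak_derivative; case: xgetP => // /(_ g). Qed.

(** The gradient is a chosen representative of an almost everywhere class, so
    integrals may be computed with any explicit weak derivative. *)
Lemma Rintegral_weak_derivative l f g h : 0 < l -> is_weak_derivative l f g ->
  square_integrable l h ->
  \int[mu]_(x in `[0, l]) (weak_derivative l f x * h x) =
  \int[mu]_(x in `[0, l]) (g x * h x).
Proof.
move=> l0 fg sh.
have fw : is_weak_derivative l f (weak_derivative l f).
  by rewrite /weak_derivative; case: xgetP => // /(_ g).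
congr fine; apply: ae_eq_integral => //.
- by apply/measurable_EFinP/measurable_funM; [exact: fw.1.1|exact: sh.1].
- by apply/measurable_EFinP/measurable_funM; [exact: fg.1.1|exact: sh.1].
have [N [mN N0 sub]] := weak_derivative_unique l0 fw fg.
exists N; split=> // x Hx; apply: sub => /= Hx'; apply: Hx => xl.
by case: (Hx' xl) => ->.
Qed.

Lemma is_weak_derivativeD l f1 f2 g1 g2 c :
  square_integrable l f1 -> square_integrable l f2 ->
  is_weak_derivative l f1 g1 -> is_weak_derivative l f2 g2 ->
  is_weak_derivative l (fun x => f1 x + c * f2 x) (fun x => g1 x + c * g2 x).
Proof.
move=> sf1 sf2 [s1 fg1] [s2 fg2]; split; first exact: square_integrableD.
move=> phi tphi; have [dphi cphi _] := tphi.
have sphi : square_integrable l phi.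
  apply/continuous_square_integrable/continuous_subspaceT => x.
  by apply: differentiable_continuous; apply/derivable1_diffP.
have sphi' : square_integrable l (derive1 phi).
  exact/continuous_square_integrable/continuous_subspaceT.
by rewrite !RintegralDM// fg1// fg2//; lra.
Qed.

(** Cauchy--Schwarz against the indicator of an interval makes every [H^1]
    function Hoelder continuous of exponent 1/2. *)
Lemma weak_derivative_holder l f g x y : {within `[0, l], continuous f} ->
  is_weak_derivative l f g -> 0 <= x -> x < y -> y <= l ->
  (f y - f x) ^+ 2 <= (y - x) * \int[mu]_(t in `[0, l]) (g t ^+ 2).
Proof.
move=> cf fg x0 xy yl; have l0 : 0 < l by lra.
have sg := fg.1.
pose h : R -> R := \1_(`]x, y]%classic).
have sh : square_integrable l h by exact: square_integrable_indic.
have xyl : `]x, y] `<=` `[0, l] by apply: subset_itvScc; rewrite bnd_simp.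
have gh : \int[mu]_(t in `[0, l]) (g t * h t) = f y - f x.
  rewrite Rintegral_mul_indic// -(@Rintegral_itvB _ _ (BLeft 0)) ?bnd_simp ?(ltW xy)//.
    by rewrite !(FTC_weak l0 cf fg); lra.
  apply: integrableS (square_integrable_integrable sg) => //.
  by apply: subset_itvl; rewrite bnd_simp.
have hh : \int[mu]_(t in `[0, l]) (h t * h t) = y - x.
  rewrite Rintegral_mul_indic// -[RHS]mul1r -(Rintegral_cst_itv false false _ (ltW xy)).
  by apply: eq_Rintegral => t xyt; rewrite /h indicE xyt.
set d := f y - f x in gh *; pose s := d / (y - x).
(* [s] minimizes the integral of [(g - s * h)^2]. *)
have : 0 <= \int[mu]_(t in `[0, l]) ((g t + - s * h t) * (g t + - s * h t)).
  by apply: Rintegral_ge0 => t _; rewrite -expr2 sqr_ge0.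
have sgh := square_integrableD (- s) sg sh.
rewrite RintegralDM//.
under eq_Rintegral do rewrite mulrC.
under [X in _ + _ * X]eq_Rintegral do rewrite mulrC.
rewrite !RintegralDM// gh hh.
have -> : \int[mu]_(t in `[0, l]) (h t * g t) = d.
  by rewrite -gh; apply: eq_Rintegral => t _; rewrite mulrC.
move=> H.
have -> : \int[mu]_(t in `[0, l]) (g t ^+ 2) = \int[mu]_(t in `[0, l]) (g t * g t).
  by apply: eq_Rintegral => t _; rewrite expr2.
have yx0 : 0 < y - x by lra.
have sE : s * (y - x) = d by rewrite /s divfK// gt_eqF.
rewrite mulrC -ler_pdivrMr// expr2 -mulrA -/s; nra.
Qed.

Lemma Rintegral_split f (t : R) l : 0 <= t <= l -> mu.-integrable `[0, l] (EFin \o f) ->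
  \int[mu]_(x in `[0, l]) f x =
  \int[mu]_(x in `[0, t]) f x + \int[mu]_(x in `]t, l]) f x.
Proof.
move=> /andP[t0 tl] fi.
by rewrite -(@Rintegral_itvB _ _ (BLeft 0) _ t)// ?bnd_simp//; lra.
Qed.

(** Integration by parts; the boundary terms vanish with the test function. *)
Lemma C1_weak_derivative l f g : 0 < l -> {within `[0, l], continuous g} ->
  derivable_oo_LRcontinuous f 0 l -> {in `]0, l[, derive1 f =1 g} ->
  is_weak_derivative l f g.
Proof.
move=> l0 cg df fg; split; first exact: continuous_square_integrable.
move=> phi [dphi cphi [a [b [a0 bl phi0]]]].
have cphi' : {within `[0, l], continuous derive1 phi} by exact: continuous_subspaceT.
have dphi' : derivable_oo_LRcontinuous phi 0 l.
  apply: (@is_derive_LRcontinuous _ (derive1 phi)) => x.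
  by rewrite derive1E; exact/derivableP.
rewrite (Rintegration_by_parts l0 cg df fg cphi' dphi' (fun _ _ => erefl)).
rewrite (phi0 0) ?(phi0 l) ?mulr0 ?subrr ?sub0r//.
  by rewrite negb_and -!ltNge bl orbT.
by rewrite negb_and -!ltNge a0.
Qed.

Lemma id_weak_derivative l : 0 < l -> is_weak_derivative l id (cst 1).
Proof.
move=> l0; apply: C1_weak_derivative => //.
- by apply: continuous_subspaceT => x; exact: cvg_cst.
- by apply: (@is_derive_LRcontinuous id (cst 1)) => x; exact: is_derive_id.
- by move=> x _; rewrite derive1E derive_val.
Qed.

Lemma cst_weak_derivative l k : 0 < l -> is_weak_derivative l (cst k) (cst 0).
Proof.
move=> l0; apply: C1_weak_derivative => //.
- by apply: continuous_subspaceT => x; exact: cvg_cst.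
- by apply: (@is_derive_LRcontinuous (cst k) (cst 0)) => x; exact: is_derive_cst.
- by move=> x _; rewrite derive1_cst.
Qed.

(** Affine functions and hinges generate the piecewise affine functions with which
    all comparisons are made. *)
Lemma hinge_weak_derivative l t : 0 < t < l ->
  is_weak_derivative l (fun x => Num.max 0 (x - t)) (\1_(`]t, l]%classic)).
Proof.
move=> /andP[t0 tl]; have l0 : 0 < l by lra.
split; first exact: square_integrable_indic.
move=> phi [dphi cphi [a [b [a0 bl phi0]]]].
have cphi' : {within `[t, l], continuous derive1 phi} by exact: continuous_subspaceT.
have cphi0 : continuous phi.
  by move=> x; apply: differentiable_continuous; apply/derivable1_diffP.
have dphi' : derivable_oo_LRcontinuous phi t l.
  apply: (@is_derive_LRcontinuous _ (derive1 phi)) => x.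
  by rewrite derive1E; exact/derivableP.
under [in RHS]eq_Rintegral do rewrite mulrC.
rewrite Rintegral_mul_indic; last by apply: subset_itvScc; rewrite bnd_simp ?lexx ?(ltW t0).
have d1 x : is_derive x 1 (fun x => x - t) (cst 1 x).
  by apply: is_derive_eq; rewrite subr0.
have c1 : {within `[t, l], continuous (cst 1 : R -> R)}.
  by apply: continuous_subspaceT => x; exact: cvg_cst.
have dt : derivable_oo_LRcontinuous (fun x => x - t) t l.
  exact: (is_derive_LRcontinuous _ _ d1).
have et : {in `]t, l[, derive1 (fun x => x - t) =1 cst 1}.
  by move=> x _; rewrite derive1E; case: (d1 x).
have := Rintegration_by_parts tl c1 dt et cphi' dphi' (fun _ _ => erefl).
rewrite (phi0 l) ?subrr ?mul0r ?mulr0 ?subrr ?sub0r; last first.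
  by rewrite negb_and -!ltNge bl orbT.
under [in X in _ = X -> _]eq_Rintegral do rewrite mul1r.
have ich h : continuous h -> mu.-integrable `[t, l] (EFin \o h).
  move=> ch; apply: continuous_compact_integrable; first exact: segment_compact.
  exact: continuous_subspaceT.
have ioc h : continuous h -> mu.-integrable `]t, l] (EFin \o h).
  by move=> ch; apply: integrableS (ich h ch) => //; exact: subset_itv_oc_cc.
have cf : continuous (fun x => (x - t) * derive1 phi x).
  move=> x; apply: cvgM; last exact: cphi.
  by apply: cvgB; [exact: cvg_id|exact: cvg_cst].
rewrite -[in X in X = _ -> _]Rintegral_itv_obnd_cbnd; last exact: ioc.
rewrite -[in X in _ = - X -> _]Rintegral_itv_obnd_cbnd; last exact: ioc.
move=> <-.
rewrite (@Rintegral_split _ t); last 2 first.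
- by rewrite !ltW.
- apply: square_integrable_mul; apply: continuous_square_integrable;
    apply: continuous_subspaceT => //.
  move=> x; apply: (@continuous_max R R (cst 0) (fun y => y - t)).
    exact: cvg_cst.
  by apply: cvgB; [exact: cvg_id|exact: cvg_cst].
rewrite [X in X + _](_ : _ = 0); last first.
  transitivity (\int[mu]_(x in `[0, t]) (cst 0 x)).
    apply: eq_Rintegral => x; rewrite inE/= in_itv/= => /andP[_ xt].
    by rewrite max_l ?mul0r// subr_le0.
  by rewrite Rintegral_cst// mul0r.
rewrite add0r; apply: eq_Rintegral => x; rewrite inE/= in_itv/= => /andP[tx _].
by rewrite max_r// subr_ge0 ltW.
Qed.

Lemma eq_within_continuous l f g :
  (forall x, 0 <= x <= l -> f x = g x) ->
  {within `[0, l], continuous f} -> {within `[0, l], continuous g}.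
Proof.
move=> fg; apply: subspace_eq_continuous => x; rewrite inE/= in_itv/=; exact: fg.
Qed.

Lemma eq_is_weak_derivative l f g h :
  (forall x, 0 <= x <= l -> f x = g x) ->
  is_weak_derivative l f h -> is_weak_derivative l g h.
Proof.
move=> fg [sh fh]; split=> // phi tphi; rewrite -fh//; apply: eq_Rintegral => x.
by rewrite inE/= in_itv/= => xl; rewrite fg.
Qed.

End WeakDerivative.

(** * The Dirichlet form *)

Section Graph.
Context {R : realType} {G : metric_graph R}.
Local Notation mu := (@lebesgue_measure R).
Implicit Types (u v w : point G -> R) (e : edge G) (c : vert G -> R) (t x y : R).

Lemma chart_src e x : x <= 0 -> chart e x = Vtx (src e) :> point G.
Proof.
move=> x0; rewrite /chart; case: pselect => [h|_]; last by rewrite x0.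
by exfalso; move: h; rewrite ltNge x0.
Qed.

Lemma chart_tgt e x : len e <= x -> chart e x = Vtx (tgt e) :> point G.
Proof.
move=> lx; rewrite /chart; case: pselect => [h|_].
  by exfalso; move: h; rewrite [_ < len e]ltNge lx andbF.
by rewrite leNgt (lt_le_trans (len_gt0 e) lx).
Qed.

Lemma chart_inner e x (h : 0 < x < len e) : chart e x = Inner e x h.
Proof. by rewrite /chart; case: pselect => // h'; congr Inner; exact: bool_irrelevance. Qed.

Lemma restr_src u e : restr u e 0 = u (Vtx (src e)).
Proof. by rewrite /restr chart_src. Qed.

Lemma restr_tgt u e : restr u e (len e) = u (Vtx (tgt e)).
Proof. by rewrite /restr chart_tgt. Qed.

Fact dirichlet_key : unit. Proof. exact: tt. Qed.

(** Locked, so that algebraic tactics never look inside the integrals. *)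
Definition dirichlet u v : R :=
  locked_with dirichlet_key
    (fun u v => graph_integral (fun e x => grad u e x * grad v e x)) u v.

Lemma dirichletE u v :
  dirichlet u v = graph_integral (fun e x => grad u e x * grad v e x).
Proof. by rewrite /dirichlet unlock. Qed.

Lemma H1_grad u e : H1 u -> is_weak_derivative (len e) (restr u e) (grad u e).
Proof. by move=> [_ hu]; exact: weak_derivativeP. Qed.

Lemma H1_continuous u e : H1 u -> {within `[0, len e], continuous (restr u e)}.
Proof. by move=> [cu _]; exact: cu. Qed.

Lemma H1_square_integrable u e : H1 u -> square_integrable (len e) (grad u e).
Proof. by move=> /H1_grad -/(_ e)[]. Qed.

Lemma H1D u v k : H1 u -> H1 v -> H1 (fun x : point G => u x + k * v x).
Proof.
move=> hu hv; split.
  move=> e x; rewrite /restr; apply: cvgD; first exact: (H1_continuous hu).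
  by apply: cvgM; [exact: cvg_cst|exact: (H1_continuous hv)].
move=> e; have := hu.2 e; have := hv.2 e => -[sv _] [su _].
split; first exact: square_integrableD.
by exists (fun x => grad u e x + k * grad v e x); apply: is_weak_derivativeD => //;
  exact: H1_grad.
Qed.

Lemma H10D u v k : H10 u -> H10 v -> H10 (fun x : point G => u x + k * v x).
Proof.
move=> [hu u0] [hv v0]; split; first exact: H1D.
by move=> a ain; rewrite u0// v0// mulr0 addr0.
Qed.

Lemma dirichletC u v : dirichlet u v = dirichlet v u.
Proof.
by rewrite !dirichletE; apply: eq_bigr => e _; apply: eq_Rintegral => x _; rewrite mulrC.
Qed.

(** The gradients of a combination and the combination of the gradients are two weak
    derivatives of the same function, hence equal almost everywhere. *)
Lemma dirichletDl u v w k : H1 u -> H1 v -> H1 w ->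
  dirichlet (fun x : point G => u x + k * v x) w = dirichlet u w + k * dirichlet v w.
Proof.
move=> hu hv hw; rewrite !dirichletE /graph_integral mulr_sumr -big_split/=.
apply: eq_bigr => e _; rewrite -RintegralDM; [|exact: H1_square_integrable..].
apply: Rintegral_weak_derivative; [exact: len_gt0| |exact: H1_square_integrable].
apply: is_weak_derivativeD; [exact: (hu.2 e).1|exact: (hv.2 e).1|exact: H1_grad..].
Qed.

Lemma dirichletDr u v w k : H1 u -> H1 v -> H1 w ->
  dirichlet w (fun x : point G => u x + k * v x) = dirichlet w u + k * dirichlet w v.
Proof.
move=> hu hv hw; rewrite dirichletC dirichletDl//.
by rewrite (dirichletC u) (dirichletC v).
Qed.

Lemma dirichlet_ge0 u : 0 <= dirichlet u u.
Proof.
rewrite dirichletE.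
by apply: sumr_ge0 => e _; apply: Rintegral_ge0 => x _; rewrite -expr2 sqr_ge0.
Qed.

Lemma dirichletDD u v k : H1 u -> H1 v ->
  dirichlet (fun x : point G => u x + k * v x) (fun x : point G => u x + k * v x) =
  dirichlet u u + 2 * k * dirichlet u v + k ^+ 2 * dirichlet v v.
Proof.
move=> hu hv; have huv := H1D k hu hv.
by rewrite dirichletDr// !dirichletDl// (dirichletC v u); ring.
Qed.

(** The discriminant argument; the form may be degenerate on [H1], as it vanishes on
    constants, so the case [dirichlet v v = 0] is separate. *)
Lemma dirichlet_CS u v : H1 u -> H1 v ->
  dirichlet u v ^+ 2 <= dirichlet u u * dirichlet v v.
Proof.
move=> hu hv.
have H k : 0 <= dirichlet u u + 2 * k * dirichlet u v + k ^+ 2 * dirichlet v v.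
  by rewrite -dirichletDD// dirichlet_ge0.
have := dirichlet_ge0 v; rewrite le_eqVlt => /predU1P[v0|v0].
  rewrite -v0 mulr0; suff -> : dirichlet u v = 0 by rewrite expr0n.
  apply/eqP; apply: contraT => uv0.
  have := H (- (dirichlet u u + 1) / (2 * dirichlet u v)).
  rewrite -v0 mulr0 addr0 => h.
  have : 2 * (- (dirichlet u u + 1) / (2 * dirichlet u v)) * dirichlet u v =
    - (dirichlet u u + 1) by field.
  lra.
have := H (- dirichlet u v / dirichlet v v).
have vn0 : dirichlet v v != 0 by rewrite gt_eqF.
have -> : dirichlet u u + 2 * (- dirichlet u v / dirichlet v v) * dirichlet u v +
   (- dirichlet u v / dirichlet v v) ^+ 2 * dirichlet v v =
   dirichlet u u - dirichlet u v ^+ 2 / dirichlet v v by field.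
by rewrite subr_ge0 ler_pdivrMr.
Qed.

Lemma edge_energy_le u e : H1 u -> \int[mu]_(x in `[0, len e]) (grad u e x ^+ 2) <= dirichlet u u.
Proof.
move=> hu; rewrite !dirichletE /graph_integral (bigD1 e)//=.
rewrite [leLHS](_ : _ = \int[mu]_(x in `[0, len e]) (grad u e x * grad u e x)).
  rewrite lerDl; apply: sumr_ge0 => e' _; apply: Rintegral_ge0 => x _.
  by rewrite -expr2 sqr_ge0.
by apply: eq_Rintegral => x _; rewrite expr2.
Qed.

Lemma edge_holder u e x y : H1 u -> 0 <= x <= len e -> 0 <= y <= len e ->
  (u (chart e y) - u (chart e x)) ^+ 2 <= `|y - x| * dirichlet u u.
Proof.
move=> hu; wlog xy : x y / x <= y.
  move=> H hx hy; have [xy|xy] := leP x y; first exact: H.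
  by rewrite distrC -sqrrN opprB; apply: H => //; exact: ltW.
move=> /andP[x0 xl] /andP[y0 yl].
move: xy; rewrite le_eqVlt => /predU1P[->|xy].
  by rewrite !subrr normr0 mul0r expr0n.
have h := weak_derivative_holder (H1_continuous hu) (H1_grad e hu) x0 xy yl.
apply: (le_trans h).
rewrite gtr0_norm ?subr_gt0//; apply: ler_wpM2l; first by rewrite subr_ge0 ltW.
exact: edge_energy_le.
Qed.

(** Every explicit function of the proof is, on each edge, affine up to one kink.
    Pairing with its step-shaped gradient integrates [grad w] over intervals, which
    yields values of [w]. *)
Lemma piecewise_affine_H1 u (s1 s2 t : edge G -> R) :
  (forall e, 0 < t e < len e) ->
  (forall e x, 0 <= x <= len e ->
     restr u e x = u (Vtx (src e)) + s1 e * x + s2 e * Num.max 0 (x - t e)) ->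
  H1 u /\ forall w, H1 w -> dirichlet u w =
    \sum_e (s1 e * (w (Vtx (tgt e)) - w (Vtx (src e))) +
            s2 e * (w (Vtx (tgt e)) - w (chart e (t e)))).
Proof.
move=> tl uE.
have cE e : {within `[0, len e], continuous (restr u e)}.
  apply: (@eq_within_continuous _ _
    (fun x => u (Vtx (src e)) + s1 e * x + s2 e * Num.max 0 (x - t e))).
    by move=> x xl; rewrite uE.
  apply: continuous_subspaceT => x; apply: cvgD.
    by apply: cvgD; [exact: cvg_cst|apply: cvgM; [exact: cvg_cst|exact: cvg_id]].
  apply: cvgM; first exact: cvg_cst.
  apply: (@continuous_max R R (cst 0) (fun y => y - t e)).
    exact: cvg_cst.
  by apply: cvgB; [exact: cvg_id|exact: cvg_cst].
have wdE e : is_weak_derivative (len e) (restr u e)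
    (fun x => (0 + s1 e * 1) + s2 e * \1_(`]t e, len e]%classic) x).
  apply: (@eq_is_weak_derivative _ _
    (fun x => (u (Vtx (src e)) + s1 e * x) + s2 e * Num.max 0 (x - t e))).
    by move=> x xl; rewrite uE.
  have sid : square_integrable (len e) id.
    by apply/continuous_square_integrable/continuous_subspaceT => x; exact: cvg_id.
  have sc k : square_integrable (len e) (cst k) by exact: square_integrable_cst.
  apply: (@is_weak_derivativeD _ _ (fun x => u (Vtx (src e)) + s1 e * x)
     _ (fun x => 0 + s1 e * 1)).
  - exact: (square_integrableD _ (sc _) sid).
  - apply/continuous_square_integrable/continuous_subspaceT => x.
    apply: (@continuous_max R R (cst 0) (fun y => y - t e)).
      exact: cvg_cst.
    by apply: cvgB; [exact: cvg_id|exact: cvg_cst].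
  - apply: (@is_weak_derivativeD _ _ (cst (u (Vtx (src e)))) id (cst 0) (cst 1)) => //.
      by apply: cst_weak_derivative; exact: len_gt0.
    by apply: id_weak_derivative; exact: len_gt0.
  - exact: hinge_weak_derivative.
have hu : H1 u.
  split=> // e; split; first exact: continuous_square_integrable.
  by eexists; exact: wdE.
split=> // w hw; rewrite dirichletE; apply: eq_bigr => e _.
have sw := H1_square_integrable e hw.
have st : square_integrable (len e) (\1_(`]t e, len e]%classic)).
  exact: square_integrable_indic.
rewrite (Rintegral_weak_derivative (len_gt0 e) (wdE e) sw).
rewrite RintegralDM//; last exact: (square_integrable_cst _ (0 + s1 e * 1)).
rewrite [X in _ + _ * X = _](_ : _ =
  \int[mu]_(x in `[0, len e]) (grad w e x * \1_(`]t e, len e]%classic) x)); last first.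
  by apply: eq_Rintegral => x _; rewrite mulrC.
have [te0 tel] := andP (tl e).
rewrite Rintegral_mul_indic; last by apply: subset_itvScc; rewrite bnd_simp ?lexx ?(ltW te0).
rewrite RintegralZl//; last exact: square_integrable_integrable.
have iw := square_integrable_integrable sw.
have FTC x xl := @FTC_weak _ _ _ _ x (len_gt0 e) (H1_continuous hw) (H1_grad e hw) xl.
rewrite -(@Rintegral_itvB _ _ (BLeft 0) _ (t e))// ?bnd_simp ?ltW//.
rewrite !FTC ?lexx ?ltW// ?len_gt0//.
rewrite restr_src restr_tgt /restr; ring.
Qed.

End Graph.

(** * Piecewise affine functions *)

Section PiecewiseAffine.
Context {R : realType} {G : metric_graph R}.
Implicit Types (u v w : point G -> R) (e : edge G) (c d : vert G -> R) (t x y : R).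

Lemma in_edgeP e x : 0 <= x <= len e -> [\/ x = 0, x = len e | 0 < x < len e].
Proof.
move=> /andP[]; rewrite le_eqVlt => /predU1P[<- _|x0]; first by constructor 1.
rewrite le_eqVlt => /predU1P[->|xl]; first by constructor 2.
by constructor 3; rewrite x0.
Qed.

Definition affine c (p : point G) : R :=
  match p with
  | Vtx v => c v
  | Inner e x _ => c (src e) + (c (tgt e) - c (src e)) / len e * x
  end.

(** The energy of the electrical network whose edge [e] has resistance [len e]. *)
Definition network_energy c d : R :=
  \sum_(e : edge G) (c (tgt e) - c (src e)) / len e * (d (tgt e) - d (src e)).

(** Only the vertex values of [w] enter, so testing on vertices suffices to solve
    the Dirichlet problem with data at the vertices. *)
Lemma affine_H1 c : H1 (affine c) /\
  forall w, H1 w -> dirichlet (affine c) w = network_energy c (fun a => w (Vtx a)).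
Proof.
have l0 e := len_gt0 e.
have [|e x xl|h1 h2] := @piecewise_affine_H1 _ _ (affine c)
  (fun e => (c (tgt e) - c (src e)) / len e) (fun=> 0) (fun e => len e / 2).
- by move=> e; have := l0 e; lra.
- rewrite mul0r addr0; have [->|->|xi] := in_edgeP xl.
  + by rewrite restr_src mulr0 addr0.
  + by rewrite restr_tgt/= divfK ?gt_eqF//; ring.
  + by rewrite /restr (chart_inner xi).
- split=> // w hw; rewrite h2//; apply: eq_bigr => e _.
  by rewrite mul0r addr0.
Qed.

(** A slope [1 / t] up to the peak at [t], then a slope [- 1 / (len e - t)], written
    as an affine function plus a hinge. *)
Definition tent e t (p : point G) : R :=
  match p with
  | Vtx _ => 0
  | Inner e' x _ => if e' == e then x / t - (t^-1 + (len e - t)^-1) * Num.max 0 (x - t)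
                    else 0
  end.

Lemma tent_H10 e t : 0 < t < len e -> H10 (tent e t) /\
  forall w, H1 w -> dirichlet (tent e t) w =
    (w (chart e t) - w (Vtx (src e))) / t - (w (Vtx (tgt e)) - w (chart e t)) / (len e - t).
Proof.
move=> tl; have l0 e' := len_gt0 e'; have /andP[t0 tl'] := tl.
have tn0 : t != 0 by rewrite gt_eqF.
have ltn0 : len e - t != 0 by rewrite gt_eqF// subr_gt0.
have [|e' x xl|h1 h2] := @piecewise_affine_H1 _ _ (tent e t)
  (fun e' => if e' == e then t^-1 else 0)
  (fun e' => if e' == e then - (t^-1 + (len e - t)^-1) else 0)
  (fun e' => if e' == e then t else len e' / 2).
- by move=> e'; case: eqP => [->//|_]; have := l0 e'; lra.
- rewrite add0r; have [->|->|xi] := in_edgeP xl.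
  + rewrite restr_src mulr0 add0r/=; case: eqP => _; last by rewrite mul0r.
    by rewrite max_l ?mulr0// sub0r oppr_le0 ltW.
  + rewrite restr_tgt/=; case: eqP => [->|_]; last by rewrite !mul0r addr0.
    rewrite max_r ?subr_ge0 ?ltW//; field.
    by rewrite ltn0 tn0.
  + rewrite /restr (chart_inner xi)/=; case: eqP => _; last by rewrite !mul0r addr0.
    by rewrite mulNr mulrC.
- split=> [//|w hw]; rewrite h2// (bigD1 e)//= big1 ?addr0.
    by rewrite eqxx; field; rewrite ltn0 tn0.
  by move=> e' /negbTE ->; rewrite !mul0r addr0.
Qed.

Lemma tent_peak e t : 0 < t < len e -> tent e t (chart e t) = 1.
Proof.
move=> tl; rewrite (chart_inner tl)/= eqxx subrr maxxx mulr0 subr0 divff//.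
by case/andP: tl => t0 _; rewrite gt_eqF.
Qed.

End PiecewiseAffine.

(** * Green functions *)

Section Green.
Context {R : realType} {G : metric_graph R}.
Hypothesis hend : V_end G != finset.set0.
Implicit Types (e : edge G) (c d : vert G -> R) (t x y : R).

Definition delta (v : vert G) : vert G -> R := fun a => (a == v)%:R.

Lemma network_energy_sum c d :
  network_energy c d = \sum_(v : vert G) d v * network_energy c (delta v).
Proof.
have dE (w : vert G) : d w = \sum_v d v * delta v w.
  rewrite (bigD1 w)//= /delta eqxx mulr1 big1 ?addr0// => v vw.
  by rewrite eq_sym (negbTE vw) mulr0.
rewrite /network_energy; under [RHS]eq_bigr do rewrite mulr_sumr.
rewrite exchange_big/=; apply: eq_bigr => e _.
rewrite (dE (tgt e)) (dE (src e)) -sumrB mulr_sumr; apply: eq_bigr => v _; ring.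
Qed.

(** Zero energy makes [c] constant along edges, and every vertex is connected to
    [V_end], where [c] vanishes. *)
Lemma network_energy_eq0 c : (forall v, v \in V_end G -> c v = 0) ->
  network_energy c c = 0 -> forall v, c v = 0.
Proof.
move=> c0 Ec v.
have Ee e : c (tgt e) = c (src e).
  have pos e' : 0 <= (c (tgt e') - c (src e')) / len e' * (c (tgt e') - c (src e')).
    by rewrite mulrAC -expr2 divr_ge0 ?sqr_ge0 ?ltW ?len_gt0.
  have /eqP := Ec; rewrite /network_energy psumr_eq0// => /allP/(_ e).
  rewrite mem_index_enum => /(_ isT) /eqP.
  rewrite mulrAC -expr2 => /eqP; rewrite mulf_eq0 sqrf_eq0 invr_eq0.
  by rewrite (gt_eqF (len_gt0 e)) orbF subr_eq0 => /eqP.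
have adj a b : adjacent a b -> c a = c b.
  move=> /existsP[e]; rewrite /incident.
  by move=> /andP[/orP[] /eqP <- /orP[] /eqP <-].
have [w wend] := set0Pn _ hend.
rewrite -(c0 _ wend); have /connectP[s] := connected_graph v w.
elim: s v => [v _ ->//|a s IH v /= /andP[va pas] wl].
by rewrite (adj _ _ va); exact: IH.
Qed.

(** The linear system [network_energy c (delta w) = delta v w] off [V_end], completed
    by [c w = 0] on [V_end], is square and injective. *)
Lemma network_green (v : vert G) : exists c : vert G -> R,
  (forall a, a \in V_end G -> c a = 0) /\
  (forall d, (forall a, a \in V_end G -> d a = 0) -> network_energy c d = d v).
Proof.
pose vT := {ffun vert G -> R^o}.
pose T (c : vT) : vT :=
  [ffun w : vert G => if w \in V_end G then c w else network_energy c (delta w)].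
have linT : linear T.
  move=> k a b; apply/ffunP => w; rewrite !ffunE; case: ifP => // _.
  rewrite /network_energy /GRing.scale/= mulr_sumr -big_split/=.
  by apply: eq_bigr => e _; rewrite !ffunE /GRing.scale/=; ring.
pose TL : {linear vT -> vT} := HB.pack T (GRing.isLinear.Build R vT vT *:%R T linT).
pose f := linfun TL.
have injf : lker f == 0%VS.
  apply/lker0P => a b; rewrite !lfunE/= => Tab.
  pose d := a - b.
  have Td (w : vert G) : T d w = 0.
    suff -> : d = (-1) *: b + a by rewrite linT Tab scaleN1r addNr ffunE.
    by rewrite /d scaleN1r addrC.
  have d0 (w : vert G) : w \in V_end G -> d w = 0 by move=> we; have := Td w; rewrite ffunE we.
  have Ed (w : vert G) : w \notin V_end G -> network_energy d (delta w) = 0.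
    by move=> we; have := Td w; rewrite ffunE (negbTE we).
  apply/eqP; rewrite -subr_eq0; apply/eqP/ffunP => w; rewrite [RHS]ffunE.
  apply: network_energy_eq0 => //.
  rewrite network_energy_sum big1// => w' _.
  by have [/d0 ->|/Ed ->] := boolP (w' \in V_end G); rewrite ?mul0r ?mulr0.
have Tinv (g : vT) : exists c : vT, T c = g.
  by exists (f^-1%VF g); have := lker0_lfunVK injf g; rewrite lfunE.
have [c Tc] := Tinv [ffun w : vert G => if w \in V_end G then 0 else delta v w].
exists c; split.
  by move=> w we; have := congr1 (fun h : vT => h w) Tc; rewrite !ffunE we.
move=> d d0; rewrite network_energy_sum.
transitivity (\sum_w d w * delta v w).
  apply: eq_bigr => w _; have [/d0 ->|we] := boolP (w \in V_end G).
    by rewrite !mul0r.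
  by have := congr1 (fun h : vT => h w) Tc; rewrite !ffunE (negbTE we) => ->.
rewrite (bigD1 v)//= /delta eqxx mulr1 big1 ?addr0// => w wv.
by rewrite (negbTE wv) mulr0.
Qed.

(** The functional [w |-> w y] is represented in the Dirichlet inner product; on an
    edge the representative interpolates those of the endpoints and adds a tent. *)
Lemma point_representer (y : point G) : exists g, H10 g /\
  forall w, H10 w -> dirichlet g w = w y.
Proof.
have vtx (a : vert G) : exists c : vert G -> R, H10 (affine c) /\
    forall w, H10 w -> dirichlet (affine c) w = w (Vtx a).
  have [c [c0 cE]] := network_green a; have [h1 h2] := affine_H1 c.
  exists c; split=> //; move=> w [hw w0].
  by rewrite h2// cE.
case: y => [a|e x xi]; first by have [c hc] := vtx a; exists (affine c).
have [c [hc cE]] := vtx (src e); have [d [hd dE]] := vtx (tgt e).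
have [ht tE] := tent_H10 xi.
pose l := len e; have l0 : 0 < l := len_gt0 e.
(* The weights are those of the affine interpolation at [x]; the height of the tent
   is the inverse of its own energy. *)
exists (fun p => (affine c p + (x / l) * (affine d p + -1 * affine c p))
               + (x * (l - x) / l) * tent e x p).
have hdc : H10 (fun p => affine d p + -1 * affine c p) by exact: H10D.
have h1 : H10 (fun p => affine c p + (x / l) * (affine d p + -1 * affine c p)).
  exact: (H10D _ hc hdc).
split; first exact: (H10D _ h1 ht).
move=> w hw; rewrite (dirichletDl _ h1.1 ht.1 hw.1).
rewrite (dirichletDl _ hc.1 hdc.1 hw.1) (dirichletDl _ hd.1 hc.1 hw.1).
rewrite cE// dE// (tE _ hw.1) (chart_inner xi).
have /andP[x0 xl] := xi; rewrite /l; field.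
by rewrite !gt_eqF ?subr_gt0.
Qed.

Lemma greenP (y : point G) : ~~ is_end y -> is_green y (green G ^~ y).
Proof.
move=> ye; have -> : green G ^~ y = xget (fun=> 0) [set g | is_green y g].
  by apply/funext => x; rewrite /green (negbTE ye).
have [g [hg gE]] := point_representer y.
case: xgetP => // /(_ g) []; split=> // w hw.
by rewrite -gE// dirichletE.
Qed.

Lemma green_H10 (y : point G) : ~~ is_end y -> H10 (green G ^~ y).
Proof. by move=> /greenP[]. Qed.

Lemma green_reproducing (y : point G) w : ~~ is_end y -> H10 w ->
  dirichlet (green G ^~ y) w = w y.
Proof. by move=> /greenP[_ gE] hw; rewrite dirichletE gE. Qed.

Lemma green_diag (y : point G) : ~~ is_end y ->
  dirichlet (green G ^~ y) (green G ^~ y) = green G y y.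
Proof. by move=> ye; rewrite green_reproducing//; exact: green_H10. Qed.

(** On [V_end] both sides vanish, the left one because [w] does. *)
Lemma green_bound (y : point G) w : H10 w -> w y ^+ 2 <= green G y y * dirichlet w w.
Proof.
move=> hw; have [ye|ye] := boolP (is_end y).
  rewrite /green ye mul0r; case: y ye => // a /= ae.
  by rewrite hw.2// expr0n.
rewrite -(green_reproducing ye hw) -green_diag//.
exact: (dirichlet_CS (green_H10 ye).1 hw.1).
Qed.

(** A Poincare inequality in the uniform norm: [green_bound] controls the finitely
    many vertices, and Hoelder continuity propagates the bound along each edge. *)
Lemma uniform_bound : exists2 C : R, 0 < C &
  forall w (x : point G), H10 w -> w x ^+ 2 <= C * dirichlet w w.
Proof.
pose A := \sum_(a : vert G) green G (Vtx a) (Vtx a).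
pose L := \sum_(e : edge G) len e.
have ga (a : vert G) : 0 <= green G (Vtx a) (Vtx a).
  have [ae|ae] := boolP (is_end (Vtx a : point G)); first by rewrite /green ae.
  by rewrite -green_diag// dirichlet_ge0.
have A0 : 0 <= A by exact: sumr_ge0.
have L0 : 0 <= L by apply: sumr_ge0 => e _; exact/ltW/len_gt0.
have hV w (a : vert G) : H10 w -> w (Vtx a) ^+ 2 <= A * dirichlet w w.
  move=> hw; apply: le_trans (green_bound _ hw) _.
  apply: ler_wpM2r; first exact: dirichlet_ge0.
  rewrite /A (bigD1 a)//= lerDl; exact: sumr_ge0.
exists (2 * (A + L) + 1); first lra.
move=> w [a|e x xi] hw; have D0 := dirichlet_ge0 w.
  by apply: le_trans (hV w a hw) _; nra.
have h1 := hV w (src e) hw.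
have /andP[x0 xl] := xi.
have hx : 0 <= x <= len e by rewrite !ltW.
have h00 : 0 <= (0 : R) <= len e by rewrite lexx ltW ?len_gt0.
have h2 := edge_holder hw.1 h00 hx.
rewrite subr0 gtr0_norm// (@chart_src _ _ e 0 (lexx 0)) (chart_inner xi) in h2.
have xL : x <= L.
  apply: (le_trans (ltW xl)); rewrite /L (bigD1 e)//= lerDl.
  by apply: sumr_ge0 => e' _; exact/ltW/len_gt0.
have h3 : x * dirichlet w w <= L * dirichlet w w by exact: ler_wpM2r.
have := sqr_ge0 (w (Vtx (src e)) - (w (Inner e x xi) - w (Vtx (src e)))).
by nra.
Qed.

Lemma green_gt0 (y : point G) w : H10 w -> w y != 0 -> 0 < green G y y.
Proof.
move=> hw wy; have := green_bound y hw; have := dirichlet_ge0 w.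
have : 0 < w y ^+ 2 by rewrite exprn_even_gt0.
by nra.
Qed.

Lemma green_inner_gt0 e x : 0 < x < len e -> 0 < green G (chart e x) (chart e x).
Proof.
move=> xi; apply: (green_gt0 (tent_H10 xi).1).
by rewrite tent_peak// oner_neq0.
Qed.

(** For [e] incident to [a], the slope at [a] of the affine function on [e] that agrees
    with [w] at both ends. *)
Definition slope (w : point G -> R) e (a : vert G) : R :=
  (w (Vtx (if src e == a then tgt e else src e)) - w (Vtx a)) / len e.

Lemma delta_H10 (a : vert G) : a \notin V_end G -> H10 (affine (delta a)).
Proof.
move=> ae; split; first exact: (affine_H1 _).1.
move=> b be; rewrite /= /delta; case: eqP => // ba.
by move: ae; rewrite -ba be.
Qed.

(** Away from [a], [affine (delta a)] has slope [- 1 / len e] along each edge at [a]. *)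
Lemma sum_slope (w : point G -> R) (a : vert G) : H1 w ->
  \sum_(e | incident e a) slope w e a = - dirichlet w (affine (delta a)).
Proof.
move=> hw; rewrite dirichletC (affine_H1 _).2// /network_energy.
rewrite -sumrN [RHS](bigID (fun e => incident e a))/= [X in _ + X]big1 ?addr0.
  apply: eq_bigr => e; rewrite /incident /slope /delta => einc.
  have := loopless e; have l0 : len e != 0 by rewrite gt_eqF// len_gt0.
  have [sa|sa] := eqVneq (src e) a.
    rewrite sa => at_; rewrite eq_sym (negbTE at_); rewrite /=; field.
    by rewrite l0.
  move: einc; rewrite (negbTE sa)/= => /eqP ->; rewrite eqxx /= => _; field.
  by rewrite l0.
move=> e; rewrite negb_or => /andP[sa ta].
by rewrite /delta (negbTE sa) (negbTE ta) subrr !mul0r oppr0.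
Qed.

Lemma affine_interpolation (A B X y l : R) : y != 0 -> l - y != 0 -> l != 0 ->
  (X - A) / y = (B - X) / (l - y) -> X = A + (B - A) / l * y.
Proof.
move=> y0 ly0 l0 /eqP; rewrite eqr_div// => /eqP H; apply: (mulIf l0).
by rewrite mulrDl mulrAC divfK//; lra.
Qed.

(** Moving away from [a] by [y] along [e] changes [G(x, x)] by
    [(1 + 2 * slope) * y + O(y^2)], so [G(x, x)] is not maximal at [a] if the slope
    exceeds -1/2.  The lower bound on [G(x, x)] comes from [green_bound] at [x] applied
    to the Green function of [a] plus a tent with peak at [x]. *)
Lemma green_max_slope (a : vert G) e : a \notin V_end G -> incident e a ->
  green_max G (Vtx a) -> 1 + 2 * slope (green G ^~ (Vtx a)) e a <= 0.
Proof.
move=> ae einc amax.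
have ae' : ~~ is_end (Vtx a : point G) by [].
set g := green G ^~ (Vtx a); set s := slope g e a.
have hg : H10 g by exact: green_H10.
have g0 : 0 < g (Vtx a).
  by apply: (green_gt0 (delta_H10 ae)); rewrite /= /delta eqxx oner_neq0.
have l0 := len_gt0 e; set l := len e in l0 *.
rewrite leNgt; apply/negP => s0.
(* At the displacement [y = l * m] the quadratic term [y^2 / l] of the lower bound is
   at most half of the linear one. *)
pose m := Num.min ((1 + 2 * s) / 2) (1 / 2).
have m0 : 0 < m by rewrite lt_min; apply/andP; split; lra.
have m1 : m <= (1 + 2 * s) / 2 by rewrite ge_min lexx.
have m2 : m <= 1 / 2 by rewrite ge_min lexx orbT.
pose y := l * m.
have y0 : 0 < y by rewrite mulr_gt0.
have yl : y < l by rewrite /y; nra.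
pose t := if src e == a then y else l - y.
have ti : 0 < t < len e by rewrite /t -/l; case: ifP => _; apply/andP; split; lra.
have [htent tE] := tent_H10 ti.
(* The optimal height of the tent, the inverse of its energy at height 1. *)
pose k := y * (l - y) / l.
have k0 : 0 < k by rewrite divr_gt0// mulr_gt0// subr_gt0.
have ly0 : l - y != 0 by rewrite gt_eqF// subr_gt0.
have lyE : l - (l - y) = y by lra.
have yn0 : y != 0 by rewrite gt_eqF.
have ln0 : l != 0 by rewrite gt_eqF.
have gtent : dirichlet g (tent e t) = 0 by rewrite green_reproducing.
have tt : dirichlet (tent e t) (tent e t) = k^-1.
  rewrite tE; last exact: htent.1.
  rewrite tent_peak// /= -/l /t /k; case: ifP => _; rewrite ?lyE; field;
    by rewrite ?lyE ?ln0 ?ly0 ?yn0.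
pose x := chart e t.
have gx : g x = g (Vtx a) + s * y.
  have := gtent; rewrite dirichletC tE; last exact: hg.1.
  rewrite -/x -/l /s /slope -/l /t.
  move: einc; rewrite /incident; case: eqVneq => [->|sa]/=.
    by move=> _ /eqP; rewrite subr_eq0 => /eqP; exact: affine_interpolation.
  move=> /eqP ->; rewrite lyE => /eqP; rewrite subr_eq0 => /eqP H.
  apply: affine_interpolation => //.
  by rewrite -opprB mulNr -H -mulNr opprB.
have DE : dirichlet (fun p => g p + k * tent e t p) (fun p => g p + k * tent e t p)
    = g (Vtx a) + k.
  rewrite dirichletDD ?gtent ?tt; [|exact: hg.1|exact: htent.1].
  rewrite (_ : dirichlet g g = g (Vtx a)); last exact: green_diag.
  by field; rewrite gt_eqF.
have := green_bound x (H10D k hg htent).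
rewrite DE tent_peak// mulr1 gx => H.
have H2 : green G x x * (g (Vtx a) + k) <= g (Vtx a) * (g (Vtx a) + k).
  by apply: ler_wpM2r; [lra|exact: amax].
have H3 : 2 * (s * y) + k <= 0.
  by have := sqr_ge0 (s * y + k); nra.
have kE : k = y * (1 - m) by rewrite /k /y; field.
rewrite kE in H3.
have : 2 * s + (1 - m) <= 0 by rewrite -(pmulr_rle0 _ y0); nra.
lra.
Qed.

Lemma V_int_edge : V_int G != finset.set0 -> inhabited (edge G).
Proof.
move=> /set0Pn[b]; rewrite inE => b3.
have [e _|none] := pickP (fun e : edge G => incident e b); first by exists.
by move: b3; rewrite /degree eq_card0// => e; rewrite inE none.
Qed.

(** Summed over the edges at [a], the quantities [1 + 2 * slope] give
    [degree a - 2], which is positive as soon as [degree a] is not 0, 1 or 2. *)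
Lemma green_max_not_vertex : V_int G != finset.set0 ->
  green_max G `<=` ~` range (@Vtx R G).
Proof.
move=> hint p pmax [a _ ap]; rewrite -ap in pmax.
have [e] := V_int_edge hint.
have [ae|ae] := boolP (a \in V_end G).
  have l0 := len_gt0 e.
  have ei : 0 < len e / 2 < len e by apply/andP; split; lra.
  have := pmax (chart e (len e / 2)); rewrite leNgt => /negP; apply.
  by rewrite {1}/green /= ae green_inner_gt0.
have := sum_slope a (green_H10 (y := Vtx a) ae).1.
rewrite green_reproducing//=; last exact: delta_H10.
rewrite /delta eqxx => S.
have : \sum_(e | incident e a) (1 + 2 * slope (green G ^~ (Vtx a)) e a) <= 0.
  by apply: sumr_le0 => e' einc; exact: green_max_slope.
rewrite big_split/= -mulr_sumr S sumr_const.
have -> : #|[pred e' | incident e' a]| = degree a.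
  by apply: eq_card => e'; rewrite inE.
have := degree_neq2 a; have : degree a != 1%N by move: ae; rewrite inE.
have : degree a != 0%N.
  apply/eqP => d0; move: S; rewrite big1 => [|e' einc].
    by move=> /eqP; rewrite eq_sym oppr_eq0 oner_eq0.
  by move: d0 => /eqP; rewrite cards_eq0 => /eqP/setP/(_ e'); rewrite !inE einc.
case: (degree a) => [//|[//|[//|n]]] _ _ _.
by have : (0 : R) <= n%:R by []; rewrite !mulrS; lra.
Qed.

End Green.

(** * Regularity of Lane--Emden solutions *)

Section AbsPower.
Context {R : realType}.
Implicit Types (p x y : R).

(** With the absolute value the power is continuous on the whole line, so that end
    points, where a solution may vanish, need no separate treatment. *)
Lemma normr_powR_continuous p : 0 < p -> continuous (fun y : R => `|y| `^ p).
Proof.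
move=> p0 y; have [->|yn0] := eqVneq y 0.
  apply/cvgrPdist_lt => e e0.
  rewrite normr0 powR0 ?gt_eqF//.
  have /cvgrPdist_lt /(_ _ e0) [d /= d0 dP] := powR_cvg0 p0.
  near=> z; rewrite sub0r normrN ger0_norm ?powR_ge0//.
  have [->|zn0] := eqVneq z 0; first by rewrite normr0 powR0 ?gt_eqF.
  have zd : ball_ Num.norm 0 d `|z|.
    by rewrite /ball_/= sub0r normrN normr_id; near: z; exists d => // z;
    rewrite /ball_/= sub0r normrN.
  have z0 : 0 < `|z| by rewrite normr_gt0.
  by have := dP _ zd z0; rewrite sub0r normrN ger0_norm ?powR_ge0.
suff h : {for `|y|, continuous (fun x : R => x `^ p)}.
  exact: (@continuous_comp R R R (fun z => `|z|) (fun x => x `^ p) y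
            (@norm_continuous _ R y) h).
apply: differentiable_continuous; apply/derivable1_diffP.
by apply: derivable_powR; rewrite in_itv/= normr_gt0 yn0.
Unshelve. all: by end_near. Qed.

Lemma within_normr_powR p (A : set R) (f : R -> R) : 0 < p ->
  {within A, continuous f} -> {within A, continuous (fun x => `|f x| `^ p)}.
Proof.
move=> p0 cf x.
apply: (@continuous_comp (subspace A) R R f (fun y => `|y| `^ p)); first exact: cf.
exact: normr_powR_continuous.
Qed.

Lemma mul_normr_powR p x : 0 < p -> `|x| * `|x| `^ p = `|x| `^ (p + 1).
Proof.
by move=> p0; rewrite -[in LHS](addrK 1 p) mulr_powRB1// ltr_wpDl// ltW.
Qed.

End AbsPower.

Section EdgeRegularity.
Context {R : realType}.
Local Notation mu := (@lebesgue_measure R).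
Implicit Types (f g q : R -> R) (l x y : R).

Lemma within_LRcontinuous f l : 0 < l -> {within `[0, l], continuous f} ->
  {in `]0, l[, forall x, derivable f x 1} -> derivable_oo_LRcontinuous f 0 l.
Proof. by move=> l0 /(continuous_within_itvP _ l0)[_ ? ?] ?; split. Qed.

(** The function [f' + int_0^x q] has zero derivative, hence is constant, and [f']
    extends continuously to the end points because the integral does. *)
Lemma C1_up_to_boundary f q l : 0 < l ->
  {within `[0, l], continuous f} -> {within `[0, l], continuous q} ->
  (forall x, 0 < x < l -> [/\ derivable f x 1, derivable (derive1 f) x 1 &
     - derive1 (derive1 f) x = q x]) ->
  exists g, [/\ {within `[0, l], continuous g}, derivable_oo_LRcontinuous f 0 l,
    {in `]0, l[, derive1 f =1 g}, derivable_oo_LRcontinuous g 0 l &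
    {in `]0, l[, derive1 g =1 (fun x => - q x)}].
Proof.
move=> l0 cf cq fq.
have iq : mu.-integrable `[0, l] (EFin \o q).
  by apply: continuous_compact_integrable; [exact: segment_compact|].
pose Q x := \int[mu]_(t in `[0, x]) q t.
have cQ : {within `[0, l], continuous Q}.
  exact: (parameterized_integral_continuous (ltW l0) iq).
have dQ x : 0 < x < l -> is_derive x 1 Q (q x).
  move=> /andP[x0 xl].
  have cqx : {for x, continuous q}.
    have /(continuous_within_itvP _ l0)[cq' _ _] := cq.
    by apply: cq'; rewrite in_itv/= x0.
  have [d1 d2] := continuous_FTC1_closed xl iq x0 cqx.
  by split; rewrite -?d2 ?derive1E.
pose k x := derive1 f x + Q x.
have dk x : 0 < x < l -> is_derive x 1 k 0.
  move=> xl; have [_ d2 e2] := fq x xl; have := dQ x xl => dQx.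
  have d2' : is_derive x 1 (derive1 f) (- q x).
    by split=> //; rewrite -derive1E -e2 opprK.
  by rewrite -(addNr (q x)); exact: is_deriveD.
have kc x : 0 < x < l -> k x = k (l / 2).
  have kk a b : 0 < a -> a < b -> b < l -> k a = k b.
    move=> a0 ab bl.
    have sub z : z \in `[a, b] -> 0 < z < l.
      by rewrite in_itv/= => /andP[az zb]; apply/andP; split; lra.
    have [||c _] := @MVT _ k (fun=> 0) a b ab.
    - by move=> z /subset_itv_oo_cc /sub /dk.
    - apply: derivable_within_continuous => z /sub /dk [] //.
    - by rewrite mul0r => /eqP; rewrite subr_eq0 => /eqP.
  move=> /andP[x0 xl]; have [h|h|-> //] := ltgtP x (l / 2).
    by apply: kk => //; lra.
  by apply/esym/kk => //; lra.
pose g x := k (l / 2) - Q x.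
have cg : {within `[0, l], continuous g}.
  by move=> x; apply: cvgB; [exact: cvg_cst|exact: cQ].
have dg x : x \in `]0, l[ -> is_derive x 1 g (- q x).
  rewrite in_itv/= => xl; rewrite -sub0r; have := dQ x xl => ?.
  exact: is_deriveB.
have df : derivable_oo_LRcontinuous f 0 l.
  by apply: within_LRcontinuous => // x; rewrite in_itv/= => /fq[].
exists g; split=> //.
- by move=> x; rewrite in_itv/= => xl; rewrite /g -(kc x xl) /k; ring.
- by apply: within_LRcontinuous => // x /dg [].
- by move=> x /dg h; rewrite derive1E derive_val.
Qed.

(** By the mean value theorem the quotient is a value of [g] close to the end point. *)
Lemma right_quotient_cvg f g l : 0 < l -> {within `[0, l], continuous g} ->
  derivable_oo_LRcontinuous f 0 l -> {in `]0, l[, derive1 f =1 g} ->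
  (f t - f 0) / t @[t --> 0^'+] --> g 0.
Proof.
move=> l0 cg df fg.
have cf := derivable_oo_LRcontinuous_within df.
have /(continuous_within_itvP _ l0)[_ g0 _] := cg.
apply/cvgrPdist_lt => e e0.
have /cvgrPdist_lt /(_ _ e0) [d /= d0 dP] := g0.
near=> t.
have t0 : 0 < t by near: t; exact: nbhs_right_gt.
have tl : t < l by near: t; exact: nbhs_right_lt.
have td : t < d by near: t; exact: nbhs_right_lt.
have [||c] := @MVT _ f (derive1 f) 0 t t0.
- move=> z; rewrite in_itv/= => /andP[z0 zt]; rewrite derive1E.
  by apply/derivableP; case: df => + _ _; apply; rewrite in_itv/= z0 (lt_trans zt).
- apply: continuous_subspaceW cf; apply: subset_itvl; rewrite bnd_simp; exact: ltW.
rewrite in_itv/= => /andP[c0 ct]; rewrite subr0 => ->.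
rewrite mulfK ?gt_eqF// fg ?in_itv/= ?c0 ?(lt_trans ct)//.
by apply: dP => //=; rewrite /ball_/= sub0r normrN gtr0_norm// (lt_trans ct).
Unshelve. all: by end_near. Qed.

Lemma left_quotient_cvg f g l : 0 < l -> {within `[0, l], continuous g} ->
  derivable_oo_LRcontinuous f 0 l -> {in `]0, l[, derive1 f =1 g} ->
  (f (l - t) - f l) / t @[t --> 0^'+] --> - g l.
Proof.
move=> l0 cg df fg.
have cf := derivable_oo_LRcontinuous_within df.
have /(continuous_within_itvP _ l0)[_ _ gl] := cg.
apply/cvgrPdist_lt => e e0.
have /cvgrPdist_lt /(_ _ e0) [d /= d0 dP] := gl.
near=> t.
have t0 : 0 < t by near: t; exact: nbhs_right_gt.
have tl : t < l by near: t; exact: nbhs_right_lt.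
have td : t < d by near: t; exact: nbhs_right_lt.
have ltl : l - t < l by lra.
have [||c] := @MVT _ f (derive1 f) (l - t) l ltl.
- move=> z; rewrite in_itv/= => /andP[z0 zt]; rewrite derive1E.
  by apply/derivableP; case: df => + _ _; apply; rewrite in_itv/= zt andbT; lra.
- by apply: continuous_subspaceW cf; apply: subset_itvr; rewrite bnd_simp; lra.
rewrite in_itv/= => /andP[c0 ct]; rewrite subKr => H.
have -> : f (l - t) - f l = - (derive1 f c * t) by lra.
rewrite mulNr mulfK ?gt_eqF// fg ?in_itv/= ?ct ?andbT; last lra.
rewrite -opprD normrN; apply: dP => //=.
by rewrite /ball_/= gtr0_norm; lra.
Unshelve. all: by end_near. Qed.

End EdgeRegularity.

Section LaneEmden.
Context {R : realType} {G : metric_graph R}.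
Local Notation mu := (@lebesgue_measure R).
Variables (p : R) (u : point G -> R).
Hypotheses (p1 : 1 < p) (hu : lane_emden_solution p u).
Implicit Types (e : edge G) (w : vert G) (x y : R).

Lemma lane_emden_ge0 e x : 0 <= x <= len e -> 0 <= restr u e x.
Proof.
move=> xl; have [cu upos _ _] := hu.
have cK : {within `[0, len e], continuous (fun x => restr u e x - `|restr u e x|)}.
  move=> z; apply: cvgB; first exact: cu.
  by apply: cvg_norm; exact: cu.
have := constant_oo_cc (len_gt0 e) cK (k := 0) _ xl.
move=> H; have /eqP : restr u e x - `|restr u e x| = 0.
  by apply: H => z /upos[uz _ _ _]; rewrite gtr0_norm// subrr.
by rewrite subr_eq0 => /eqP ->.
Qed.

Lemma lane_emden_gradient : exists g : edge G -> R -> R, forall e,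
  [/\ {within `[0, len e], continuous (g e)},
      derivable_oo_LRcontinuous (restr u e) 0 (len e),
      {in `]0, len e[, derive1 (restr u e) =1 g e},
      derivable_oo_LRcontinuous (g e) 0 (len e) &
      {in `]0, len e[, derive1 (g e) =1 (fun x => - `|restr u e x| `^ p)}].
Proof.
have [cu upos _ _] := hu.
suff H e : exists g,
  [/\ {within `[0, len e], continuous g},
      derivable_oo_LRcontinuous (restr u e) 0 (len e),
      {in `]0, len e[, derive1 (restr u e) =1 g},
      derivable_oo_LRcontinuous g 0 (len e) &
      {in `]0, len e[, derive1 g =1 (fun x => - `|restr u e x| `^ p)}].
  by have [g gP] := choice H; exists g.
apply: C1_up_to_boundary; first exact: len_gt0.
- exact: cu.
- exact: (within_normr_powR (lt_trans ltr01 p1) (cu e)).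
- by move=> x /upos[u0 ? ? ?]; split=> //; rewrite gtr0_norm.
Qed.

(** A solution is [C^1] up to the ends of each edge, so its classical derivative is a
    weak one. *)
Lemma lane_emden_H10 : H10 u.
Proof.
have [cu _ _ u0] := hu; have [g gP] := lane_emden_gradient.
split=> //; split=> // e; split; first exact: continuous_square_integrable.
by have [h1 h2 h3 _ _] := gP e; exists (g e); apply: C1_weak_derivative; rewrite ?len_gt0.
Qed.

Lemma degree0_incident e w : degree w = 0%N -> ~~ incident e w.
Proof.
move=> d0; apply/negP => einc.
by have := card0_eq d0 e; rewrite inE einc.
Qed.

(** Integrate [u'' u] by parts on every edge.  Regrouped by vertices, the boundary
    terms are [u w] times the sum of the outward derivatives at [w]: one factor vanishes
    at each vertex. *)
Lemma lane_emden_nehari :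
  dirichlet u u = graph_integral (fun e x => `|restr u e x| `^ (p + 1)).
Proof.
have [cu upos kir u0] := hu; have [g gP] := lane_emden_gradient.
have hH := lane_emden_H10.
have l0 e : 0 < len e := len_gt0 e.
have wd e : is_weak_derivative (len e) (restr u e) (g e).
  by have [h1 h2 h3 _ _] := gP e; exact: C1_weak_derivative.
have sg e := (wd e).1.
pose bd e := u (Vtx (tgt e)) * g e (len e) - u (Vtx (src e)) * g e 0.
have edgeE e : \int[mu]_(x in `[0, len e]) (grad u e x * grad u e x) =
    bd e + \int[mu]_(x in `[0, len e]) (`|restr u e x| `^ (p + 1)).
  have [h1 h2 h3 h4 h5] := gP e.
  rewrite (Rintegral_weak_derivative (l0 e) (wd e) (H1_square_integrable e hH.1)).
  rewrite (_ : \int[mu]_(x in `[0, len e]) (g e x * grad u e x) =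
      \int[mu]_(x in `[0, len e]) (grad u e x * g e x)); last first.
    by apply: eq_Rintegral => x _; rewrite mulrC.
  rewrite (Rintegral_weak_derivative (l0 e) (wd e) (sg e)).
  have cq : {within `[0, len e], continuous (fun x => - `|restr u e x| `^ p)}.
    have cup : {within `[0, len e], continuous (fun x => `|restr u e x| `^ p)}.
      exact: (within_normr_powR (lt_trans ltr01 p1) (cu e)).
    by move=> x; apply: cvgN; exact: cup.
  rewrite (Rintegration_by_parts (l0 e) cq h4 h5 h1 h2 h3).
  rewrite restr_src restr_tgt /bd [u (Vtx (tgt e)) * _]mulrC [u (Vtx (src e)) * _]mulrC.
  congr (_ + _).
  rewrite -mulN1r -RintegralZl//; last first.
    have scu := continuous_square_integrable (cu e).
    exact: (square_integrable_mul (continuous_square_integrable cq) scu).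
  apply: eq_Rintegral => x; rewrite inE/= in_itv/= => xl.
  rewrite -(mul_normr_powR _ (lt_trans ltr01 p1)).
  by rewrite (ger0_norm (lane_emden_ge0 xl)); ring.
rewrite dirichletE /graph_integral (eq_bigr _ (fun e _ => edgeE e)) big_split/=.
rewrite [X in X + _](_ : _ = 0) ?add0r//.
pose od e w := if src e == w then g e 0 else - g e (len e).
have odE e w : incident e w -> outward_derivative u e w = od e w.
  have [h1 h2 h3 h4 h5] := gP e.
  move=> einc; apply: cvg_lim; first exact: Rhausdorff.
  rewrite /outward_quotient /along /od; move: einc; rewrite /incident.
  case: eqVneq => [<- _|sw /= /eqP <-].
    have := right_quotient_cvg (l0 e) h1 h2 h3.
    by rewrite /restr chart_src.
  have := left_quotient_cvg (l0 e) h1 h2 h3.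
  by rewrite /restr chart_tgt.
have vtx w : u (Vtx w) * \sum_(e | incident e w) od e w = 0.
  have [we|we] := boolP (w \in V_end G); first by rewrite u0// mul0r.
  have [wi|wi] := boolP (w \in V_int G).
    by rewrite -(eq_bigr _ (odE ^~ w)) (kir _ wi).2 mulr0.
  rewrite big1 ?mulr0// => e einc.
  move: we wi; rewrite !inE -leqNgt.
  have := degree_neq2 w.
  case dw : (degree w) => [|[|[|n]]]//.
  by move: (degree0_incident e dw); rewrite einc.
have : \sum_w u (Vtx w) * \sum_(e | incident e w) od e w = 0 by rewrite big1.
under [X in X = 0 -> _]eq_bigr do rewrite mulr_sumr.
rewrite (exchange_big_dep predT)//= => H.
apply/eqP; rewrite -oppr_eq0 -sumrN -[X in _ == X]H; apply/eqP/eq_bigr => e _.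
have st := loopless e.
rewrite (bigD1 (src e)) /incident ?eqxx//= (bigD1 (tgt e)) ?eqxx ?orbT ?[tgt e == _]eq_sym//=.
rewrite big1 => [|w /andP[/andP[/orP[/eqP <-|/eqP <-]]]]; last 2 first.
- by rewrite eqxx.
- by rewrite eqxx.
by rewrite addr0 /od eqxx (negbTE st) /bd; ring.
Qed.

End LaneEmden.

(** * Comparison of least energies *)

Section RealPowers.
Context {R : realType}.
Implicit Types (p s t A d c : R).

(** The maximum over [t] is attained at [t1 = (A / d) `^ (p - 1)^-1]; in the variable
    [t / t1] this is Young's inequality between [(t / t1)^2] and 1, with exponents
    [(p + 1) / 2] and [(p + 1) / (p - 1)]. *)
Lemma fibering_max p A d t : 1 < p -> 0 < A -> 0 < d -> 0 < t ->
  2^-1 * (t ^+ 2 * A) - (p + 1)^-1 * (t `^ (p + 1) * d) <=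
  (2^-1 - (p + 1)^-1) * (A * (A / d) `^ (2 / (p - 1))).
Proof.
move=> p1 A0 d0 t0.
have p10 : p - 1 != 0 by rewrite gt_eqF// subr_gt0.
have pp1 : p + 1 != 0 by rewrite gt_eqF//; lra.
have Ad : 0 < A / d by rewrite divr_gt0.
pose t1 := (A / d) `^ (p - 1)^-1.
have t10 : 0 < t1 by rewrite powR_gt0.
have t1p : t1 `^ (p + 1) * d = t1 ^+ 2 * A.
  have -> : p + 1 = 2%:R + (p - 1) by ring.
  rewrite powRD; last by rewrite (gt_eqF t10) implybT.
  rewrite powR_mulrn ?ltW// -mulrA; congr (_ * _).
  by rewrite /t1 -powRrM mulVf// powRr1 ?divfK ?ltW// gt_eqF.
have t12 : (A / d) `^ (2 / (p - 1)) = t1 ^+ 2.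
  by rewrite [2 / _]mulrC powRrM -/t1 -(@powR_mulrn _ t1 2)// ltW.
pose s := t / t1.
have s0 : 0 < s by rewrite divr_gt0.
have tE : t = s * t1 by rewrite /s divfK// gt_eqF.
have young : s ^+ 2 <= (s `^ (p + 1)) / ((p + 1) / 2) + 1 / ((p + 1) / (p - 1)).
  have := @conjugate_powR R (s ^+ 2) 1 ((p + 1) / 2) ((p + 1) / (p - 1)).
  have -> : (s ^+ 2) `^ ((p + 1) / 2) = s `^ (p + 1).
    by rewrite -(@powR_mulrn _ s 2) ?ltW// -powRrM mulrCA divff ?mulr1.
  rewrite mulr1 powR1.
  apply; rewrite ?sqr_ge0 ?powR_ge0// ?divr_gt0//; try lra.
  by field; rewrite pp1 p10.
rewrite t12 tE exprMn powRM ?(ltW s0) ?(ltW t10)// -(mulrA (s `^ (p + 1))) t1p.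
have tA : 0 <= t1 ^+ 2 * A / 2 by rewrite divr_ge0// mulr_ge0 ?sqr_ge0// ltW.
have H := ler_wpM2l tA young.
rewrite -subr_ge0 in H; rewrite -subr_ge0.
apply: le_trans H _; rewrite le_eqVlt; apply/orP; left; apply/eqP; field.
by rewrite pp1 p10.
Qed.

Lemma sqr_lt (x y : R) : 0 < y -> x ^+ 2 < y ^+ 2 -> x < y.
Proof. by move=> y0 xy; rewrite ltNge; apply/negP => yx; nra. Qed.

(** The constants of the estimates enter only through such roots. *)
Lemma powR_cvg1 (p_ : nat -> R) c k : 0 < c -> p_ n @[n --> \oo] --> +oo ->
  c `^ (k / (p_ n - 1)) @[n --> \oo] --> (1 : R).
Proof.
move=> c0 poo.
have inv0 : (p_ n - 1)^-1 @[n --> \oo] --> (0 : R).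
  apply/cvgrPdist_lt => e e0; near=> n.
  have h : 1 + e^-1 < p_ n by near: n; move/cvgryPgt : poo; apply.
  have ei : 0 < e^-1 by rewrite invr_gt0.
  rewrite sub0r normrN gtr0_norm ?invr_gt0; last lra.
  by rewrite invf_plt ?posrE; lra.
have -> : (fun n => c `^ (k / (p_ n - 1))) = (fun n => expR (k / (p_ n - 1) * ln c)).
  by apply/funext => n; rewrite /powR gt_eqF.
rewrite -[X in _ --> X](@expR0 R); apply: continuous_cvg; first exact: continuous_expR.
rewrite -[X in _ --> X](mul0r (ln c)); apply: cvgM; last exact: cvg_cst.
by rewrite -[X in _ --> X](mulr0 k); apply: cvgM; [exact: cvg_cst|exact: inv0].
Unshelve. all: by end_near. Qed.

End RealPowers.

Section LeastEnergy.
Context {R : realType} {G : metric_graph R}.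
Local Notation mu := (@lebesgue_measure R).
Hypothesis hend : V_end G != finset.set0.
Implicit Types (u v : point G -> R) (e : edge G) (w : vert G) (p x y : R).

Lemma energyE p v : energy p v = 2^-1 * dirichlet v v -
  (p + 1)^-1 * graph_integral (fun e x => `|restr v e x| `^ (p + 1)).
Proof.
rewrite /energy dirichletE; congr (_ * _ - _); apply: eq_bigr => e _.
by apply: eq_Rintegral => x _; rewrite real_normK ?num_real// expr2.
Qed.

Lemma H10Z k v : H10 v -> H10 (fun x : point G => k * v x).
Proof.
move=> hv; have := H10D (k - 1) hv hv.
by congr H10; apply/funext => x; ring.
Qed.

Lemma dirichletZ k v : H10 v ->
  dirichlet (fun x : point G => k * v x) (fun x : point G => k * v x) =
  k ^+ 2 * dirichlet v v.
Proof.
move=> hv; have := dirichletDD (k - 1) hv.1 hv.1.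
rewrite (_ : (fun x : point G => v x + (k - 1) * v x) = (fun x : point G => k * v x)).
  by move=> ->; ring.
by apply/funext => x; ring.
Qed.

Lemma energy_scale_le p v e (c d t : R) : 1 < p -> H10 v -> 0 <= c -> c < d ->
  d <= len e -> (forall x, c <= x <= d -> 1 <= `|v (chart e x)|) -> 0 < t ->
  energy p (fun x : point G => t * v x) <=
  2^-1 * (t ^+ 2 * dirichlet v v) - (p + 1)^-1 * (t `^ (p + 1) * (d - c)).
Proof.
move=> p1 hv c0 cd dl v1 t0; rewrite energyE dirichletZ//.
have hz := H10Z t hv.
have p0 : 0 < p + 1 by lra.
rewrite lerD2l lerN2; apply: ler_wpM2l; first by rewrite invr_ge0 ltW.
rewrite /graph_integral (bigD1 e)//=.
apply: ler_wpDr.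
  by apply: sumr_ge0 => e' _; apply: Rintegral_ge0 => x _; exact: powR_ge0.
have sub : `]c, d] `<=` `[0, len e] by apply: subset_itvScc; rewrite bnd_simp.
have -> : t `^ (p + 1) * (d - c) =
    \int[mu]_(x in `[0, len e]) (t `^ (p + 1) * \1_(`]c, d]%classic) x).
  by rewrite Rintegral_mul_indic// Rintegral_cst_itv ?ltW.
have cz : {within `[0, len e], continuous (fun x =>
    `|restr (fun x : point G => t * v x) e x| `^ (p + 1))}.
  exact: (within_normr_powR p0 (H1_continuous hz.1)).
apply: le_Rintegral => //.
- apply: square_integrable_integrable.
  have sI := @square_integrable_indic R (len e) `]c, d]%classic.
  have := square_integrableD (t `^ (p + 1)) (square_integrable_cst (len e) 0) (sI _).
  move=> /(_ (measurable_itv _)); congr square_integrable.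
  by apply/funext => x; rewrite /cst/= add0r.
- apply: continuous_compact_integrable; first exact: segment_compact.
  exact: cz.
move=> x _; rewrite indicE.
have [|_] := boolP (x \in `]c, d]%classic); last by rewrite mulr0 powR_ge0.
rewrite inE/= in_itv/= => /andP[cx xd]; rewrite mulr1 /restr.
apply: ge0_ler_powR; rewrite ?nnegrE ?(ltW p0) ?(ltW t0)//.
rewrite normrM gtr0_norm// ler_peMr ?(ltW t0)// v1// xd andbT.
exact: ltW.
Qed.

(** Test the least energy level with the fibre through [v]; on the solution the level is
    [(1/2 - 1/(p + 1)) * dirichlet u u], and the common factor cancels. *)
Lemma least_energy_dirichlet_le p u v e (c d : R) : 1 < p ->
  least_energy_solution p u -> H10 v -> 0 <= c -> c < d ->
  d <= len e -> (forall x, c <= x <= d -> 1 <= `|v (chart e x)|) ->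
  dirichlet u u <= dirichlet v v * (dirichlet v v / (d - c)) `^ (2 / (p - 1)).
Proof.
move=> p1 [solu leu] hv c0 cd dl v1.
have vc : v (chart e c) != 0.
  by rewrite -normr_gt0 (lt_le_trans ltr01)// v1// lexx ltW.
have A0 : 0 < dirichlet v v.
  have := green_bound hend (chart e c) hv.
  have : 0 < v (chart e c) ^+ 2 by rewrite exprn_even_gt0.
  by have := green_gt0 hend hv vc; have := dirichlet_ge0 v; nra.
have dc0 : 0 < d - c by lra.
have Eu : energy p u = (2^-1 - (p + 1)^-1) * dirichlet u u.
  by rewrite energyE -(lane_emden_nehari p1 solu); ring.
have k0 : 0 < 2^-1 - (p + 1)^-1 :> R.
  rewrite subr_gt0 ltf_pV2 ?posrE; lra.
rewrite -(ler_pM2l k0) -Eu -lee_fin leu.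
apply: ge_ereal_inf; eexists.
  by exists v; [split=> //; exists (chart e c)|reflexivity].
apply: ge_ereal_sup => _ [t t0 <-]; rewrite lee_fin.
apply: le_trans (energy_scale_le p1 hv c0 cd dl v1 t0) _.
exact: fibering_max.
Qed.

Lemma nonend_chart (y : point G) : ~~ is_end y ->
  exists e x, 0 <= x <= len e /\ y = chart e x.
Proof.
case: y => [a ae|e x xi _]; last first.
  exists e, x; split; first by case/andP: xi => ? ?; rewrite !ltW.
  by rewrite chart_inner.
have [e|none] := pickP (fun e : edge G => incident e a).
  rewrite /incident; case: eqVneq => [<- _|_ /= /eqP <-].
    by exists e, 0; rewrite lexx ltW ?len_gt0// chart_src.
  by exists e, (len e); rewrite lexx ltW ?len_gt0// chart_tgt.
have := sum_slope a (green_H10 hend ae).1.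
rewrite green_reproducing//=; last exact: delta_H10.
rewrite /delta eqxx big1 => [/eqP|e]; last by rewrite none.
by rewrite eq_sym oppr_eq0 oner_eq0.
Qed.

End LeastEnergy.

(** * Concentration of the maximum *)

Section Concentration.
Context {R : realType} {G : metric_graph R}.
Local Notation mu := (@lebesgue_measure R).
Hypotheses (hint : V_int G != finset.set0) (hend : V_end G != finset.set0).
Variable u : R -> point G -> R.
Hypothesis hu : forall p : R, 1 < p -> least_energy_solution p (u p).
Variable p_ : nat -> R.
Hypotheses (p1 : forall n, 1 < p_ n) (poo : p_ n @[n --> \oo] --> +oo).
Implicit Types (e : edge G) (x y : R).

Let A n := dirichlet (u (p_ n)) (u (p_ n)).

Let u_H10 n : H10 (u (p_ n)).
Proof. exact: (lane_emden_H10 (p1 n) (hu (p1 n)).1). Qed.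

(** The competitor is [(1 + eta) * G(., a) / G(a, a)], which exceeds 1 on an interval
    around [a]; its energy is [(1 + eta)^2 / G(a, a)], and the length of the interval
    only contributes a factor tending to 1. *)
Lemma energy_limsup (a : point G) (eps : R) : 0 < green G a a -> 0 < eps ->
  \forall n \near \oo, A n <= (green G a a)^-1 + eps.
Proof.
move=> g0 eps0; set g := green G a a in g0 *.
have ae : ~~ is_end a by apply/negP => ae; move: g0; rewrite /g /green ae ltxx.
have gn0 : g != 0 by rewrite gt_eqF.
pose eta := Num.min 1 (eps * g / 6).
have eg0 : 0 < eps * g / 6 by rewrite divr_gt0// mulr_gt0.
have eta0 : 0 < eta by rewrite lt_min ltr01.
have eta1 : eta <= 1 by rewrite ge_min lexx.
have eta2 : eta <= eps * g / 6 by rewrite ge_min lexx orbT.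
have [e [x [xl aE]]] := nonend_chart hend ae.
pose k := (1 + eta) / g.
pose v (z : point G) := k * green G z a.
have hv : H10 v by apply: H10Z; exact: green_H10.
have va : v a = 1 + eta by rewrite /v /k -/g divfK.
have Dv : dirichlet v v = (1 + eta) ^+ 2 / g.
  by rewrite dirichletZ ?green_diag//; [rewrite /k -/g; field|exact: green_H10].
have Dv0 : 0 < dirichlet v v by rewrite Dv divr_gt0// exprn_gt0// addr_gt0.
have Dle : dirichlet v v <= g^-1 + eps / 2.
  rewrite Dv ler_pdivrMr// mulrDl mulVf//; nra.
(* By Hoelder continuity [v] varies by at most [eta] over a distance [r]. *)
pose r := eta ^+ 2 / dirichlet v v.
have r0 : 0 < r by rewrite divr_gt0// exprn_gt0.
pose c := Num.max 0 (x - r); pose d := Num.min (len e) (x + r).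
have l0 := len_gt0 e; have /andP[x0 x1] := xl.
have c0 : 0 <= c by rewrite le_max lexx.
have dl : d <= len e by rewrite ge_min lexx.
have cd : c < d by rewrite gt_max !lt_min; apply/andP; split; apply/andP; split; lra.
have v1 y : c <= y <= d -> 1 <= `|v (chart e y)|.
  move=> /andP[]; rewrite ge_max le_min => /andP[y0 yr] /andP[yl yr'].
  have yl' : 0 <= y <= len e by rewrite y0.
  have := edge_holder hv.1 xl yl'; rewrite -aE va => H.
  have yxr : `|y - x| <= r by rewrite ler_norml; apply/andP; split; lra.
  have : `|y - x| * dirichlet v v <= eta ^+ 2.
    by rewrite -ler_pdivlMr.
  move=> /(le_trans H) H2; rewrite ger0_norm; last by nra.
  by rewrite leNgt; apply/negP => vy; nra.
have Q0 : 0 < dirichlet v v / (d - c) by rewrite divr_gt0// subr_gt0.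
have /cvgrPdist_lt := powR_cvg1 2 Q0 poo.
move=> /(_ (eps / 2 / dirichlet v v)); rewrite !divr_gt0// => /(_ isT).
apply: filterS => n; rewrite ltr_distlC => /andP[_ Qn].
have := least_energy_dirichlet_le hend (p1 n) (hu (p1 n)) hv c0 cd dl v1.
move=> /le_trans; apply; rewrite -ler_pdivlMl//; apply: (le_trans (ltW Qn)).
rewrite ler_pdivlMl// mulrDr mulr1 mulrC divfK ?gt_eqF//; lra.
Qed.

Lemma subsequence_edge (e_ : nat -> edge G) (x_ : nat -> R) :
  (forall n, 0 <= x_ n <= len (e_ n)) ->
  exists k e x, [/\ {homo k : m n / (m < n)%N}, forall n, e_ (k n) = e,
    0 <= x <= len e & x_ (k n) @[n --> \oo] --> x].
Proof.
move=> xl.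
have fin : finite_set (range e_) by exact: finite_finset.
have [e [B Boo Be]] := finite_range_cst_subsequence fin.
have /= [|f [fincr _ Bf]] := infinite_increasing_seq_wf _ Boo 0%N.
  by move=> n; apply: sub_finite_set (finite_II n.+1) => m /=.
have [|h hincr hcvg] := @bolzano_weierstrass R (x_ \o f).
  exists (len e); split; first exact: num_real.
  move=> M lM n _ /=; have := xl (f n); rewrite ((Be _).1 (Bf n)) => /andP[x0 x1].
  by rewrite ger0_norm// (le_trans x1)// ltW.
have incr_homo (k : nat -> nat) : {mono k : n m / (n <= m)%N >-> (n <= m)%O} ->
    {homo k : m n / (m < n)%N}.
  by move=> kincr m n; rewrite !ltnNge => mn; rewrite -[X in ~~ X]kincr in mn.
exists (f \o h), e, (lim ((x_ \o f) \o h @ \oo)); split.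
- by move=> m n mn /=; apply: (incr_homo f) => //; apply: (incr_homo h).
- by move=> n /=; exact: (Be _).1 (Bf _).
- have bnd n : 0 <= ((x_ \o f) \o h) n <= len e.
    by have := xl (f (h n)); rewrite ((Be _).1 (Bf _)).
  apply/andP; split.
    by apply: limr_ge => //; near=> n; case/andP: (bnd n).
  by apply: limr_le => //; near=> n; case/andP: (bnd n).
- exact: hcvg.
Unshelve. all: by end_near. Qed.

Lemma edge_max (v : point G -> R) : continuous_on_graph v ->
  exists e x, 0 <= x <= len e /\
    forall e' y, 0 <= y <= len e' -> v (chart e' y) <= v (chart e x).
Proof.
move=> cv.
have [e0] := V_int_edge hint.
have H e : exists x, x \in `[0, len e] /\
    forall y, y \in `[0, len e] -> restr v e y <= restr v e x.
  by have [x] := EVT_max (ltW (len_gt0 e)) (cv e); exists x.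
have [m mP] := choice H.
pose e := [arg max_(e > e0) restr v e (m e)]%O.
exists e, (m e); split; first by have [] := mP e; rewrite in_itv.
move=> e' y yl; have [_ /(_ y)] := mP e'; rewrite in_itv/= => /(_ yl) /le_trans; apply.
by rewrite /e; case: arg_maxP => // i _; apply.
Qed.

(** If [m] is the maximum of [u p], then [m^2 <= C * A <= C * L * m^(p + 1)], where [A]
    is the energy in its two forms and [L] the total length. *)
Lemma near_peak : exists2 kappa : R, 0 < kappa & forall p, 1 < p ->
  exists e x, 0 <= x <= len e /\ kappa `^ (1 / (p - 1)) <= u p (chart e x).
Proof.
have [C C0 hC] := uniform_bound hend.
pose L := \sum_(e : edge G) len e.
have [e0] := V_int_edge hint.
have L0 : 0 < L.
  rewrite /L (bigD1 e0)//= ltr_pwDl ?len_gt0//.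
  by apply: sumr_ge0 => e _; exact/ltW/len_gt0.
exists (C * L)^-1; first by rewrite invr_gt0 mulr_gt0.
move=> p pgt1; have [sol _] := hu pgt1; have [cu upos _ _] := sol.
have [e [x [xl xmax]]] := edge_max cu.
exists e, x; split=> //; set m := u p (chart e x) in xmax *.
have p0 : 0 < p by lra.
have m0 : 0 < m.
  have l0 := len_gt0 e0.
  have h1 : 0 < len e0 / 2 < len e0 by apply/andP; split; lra.
  have h2 : 0 <= len e0 / 2 <= len e0 by apply/andP; split; lra.
  by apply: lt_le_trans (xmax e0 _ h2); have [] := upos e0 _ h1.
have uH := lane_emden_H10 pgt1 sol.
have AL : dirichlet (u p) (u p) <= m `^ (p + 1) * L.
  rewrite (lane_emden_nehari pgt1 sol) /L mulr_sumr; apply: ler_sum => e' _.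
  have -> : m `^ (p + 1) * len e' = \int[mu]_(x in `[0, len e']) (cst (m `^ (p + 1)) x).
    by rewrite Rintegral_cst_itv ?subr0// ltW ?len_gt0.
  apply: le_Rintegral => //.
  - apply: continuous_compact_integrable; first exact: segment_compact.
    by apply: within_normr_powR; [rewrite addr_gt0|exact: cu].
  - exact/square_integrable_integrable/square_integrable_cst.
  move=> y; rewrite /= in_itv/= => yl.
  have u0 := lane_emden_ge0 sol yl.
  rewrite (ger0_norm u0); apply: ge0_ler_powR; rewrite ?nnegrE ?(ltW m0)//.
    by rewrite addr_ge0// ltW.
  exact: xmax.
have mC := hC _ (chart e x) uH; rewrite -/m in mC.
have H : m ^+ 2 <= C * (m `^ (p + 1) * L).
  by apply: (le_trans mC); rewrite ler_pM2l.
have mE : m `^ (p + 1) = m ^+ 2 * m `^ (p - 1).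
  have -> : p + 1 = 2%:R + (p - 1) by ring.
  rewrite powRD; last by rewrite (gt_eqF m0) implybT.
  by rewrite powR_mulrn// ltW.
have H2 : (C * L)^-1 <= m `^ (p - 1).
  rewrite invf_ple ?posrE ?powR_gt0 ?mulr_gt0//.
  have m20 : 0 < m ^+ 2 by rewrite exprn_gt0.
  rewrite -(ler_pM2l m20) ler_pdivrMr ?powR_gt0//.
  by move: H; rewrite mE; congr (_ <= _); ring.
have k0 : 0 <= 1 / (p - 1) by rewrite divr_ge0// subr_ge0 ltW.
have := ge0_ler_powR k0 _ _ H2; rewrite !nnegrE invr_ge0 powR_ge0.
rewrite mulr_ge0 ?(ltW C0) ?(ltW L0)// => /(_ isT isT).
by rewrite -powRrM mul1r divff ?powRr1 ?(ltW m0)// gt_eqF// subr_gt0.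
Qed.

(** The energies are bounded, so the solutions are uniformly Hoelder continuous and
    their values at [x_ n] and at the limit [x] differ by a vanishing quantity. *)
Lemma peak_limit e x (x_ : nat -> R) (kappa : R) : 0 < kappa ->
  0 <= x <= len e -> (forall n, 0 <= x_ n <= len e) -> x_ n @[n --> \oo] --> x ->
  (forall n, kappa `^ (1 / (p_ n - 1)) <= u (p_ n) (chart e (x_ n))) ->
  forall eps : R, 0 < eps -> \forall n \near \oo, 1 - eps <= u (p_ n) (chart e x).
Proof.
move=> k0 xl x_l cx peak eps eps0.
have l0 := len_gt0 e.
have ei : 0 < len e / 2 < len e by apply/andP; split; lra.
have g0 := green_inner_gt0 hend ei.
set g := green G _ _ in g0.
pose B := g^-1 + 1.
have B0 : 0 < B by rewrite addr_gt0// invr_gt0.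
have d0 : 0 < (eps / 2) ^+ 2 / B by rewrite divr_gt0// exprn_gt0// divr_gt0.
have eps20 : 0 < eps / 2 by rewrite divr_gt0.
have /cvgrPdist_lt /(_ _ eps20) near1 := powR_cvg1 1 k0 poo.
have /cvgrPdist_lt /(_ _ d0) near2 := cx.
near=> n.
have An : A n <= B by near: n; exact: energy_limsup.
have h1 : `|1 - kappa `^ (1 / (p_ n - 1))| < eps / 2 by near: n.
have h2 : `|x - x_ n| < (eps / 2) ^+ 2 / B by near: n.
have := peak n; have := edge_holder (u_H10 n).1 xl (x_l n).
rewrite distrC -/(A n) => H.
have A0 : 0 <= A n by exact: dirichlet_ge0.
have : `|x - x_ n| * A n <= (eps / 2) ^+ 2.
  have Bn0 : B != 0 by rewrite gt_eqF.
  rewrite -(divfK Bn0 ((eps / 2) ^+ 2)).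
  by apply: ler_pM => //; exact: ltW.
move=> /(le_trans H) H2.
move: h1; rewrite ltr_distlC => /andP[h1 _].
set a := u (p_ n) (chart e (x_ n)) in H2 *; set b := u (p_ n) (chart e x) in H2 *.
move=> pk; have : a - b <= eps / 2 by rewrite leNgt; apply/negP => ab; nra.
lra.
Unshelve. all: by end_near. Qed.

(** Concentrating at [a] costs at least [1 / G(a, a)], while the energies are
    asymptotically at most [1 / G(y, y)] for every [y]. *)
Lemma peak_limit_max (a : point G) :
  (forall eps : R, 0 < eps -> \forall n \near \oo, 1 - eps <= u (p_ n) a) ->
  [/\ green_max G a, 0 < green G a a & ~~ is_end a].
Proof.
move=> ua.
have ae : ~~ is_end a.
  apply/negP => ae; have h2 : 0 < 1 / 2 :> R by lra.
  have [N _ /(_ N (leqnn N))] := ua _ h2.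
  case: a ae {ua} => // w we; rewrite (u_H10 N).2//; lra.
have ga0 : 0 < green G a a.
  have h2 : 0 < 1 / 2 :> R by lra.
  have [N _ /(_ N (leqnn N)) uN] := ua _ h2.
  by apply: (green_gt0 hend (u_H10 N)); rewrite gt_eqF//; lra.
split=> // y; have [y0|y0] := leP (green G y y) 0; first exact: (le_trans y0 (ltW ga0)).
set g := green G a a in ga0 *; set h := green G y y in y0 *.
rewrite leNgt; apply/negP => gh.
(* With this [eps], [g * (h^-1 + eps)] is smaller than [(1 - eps)^2]. *)
have hg1 : g / h < 1 by rewrite ltr_pdivrMr ?mul1r.
pose eps := (1 - g / h) / (2 + g).
have eps0 : 0 < eps by rewrite divr_gt0 ?subr_gt0// addr_gt0.
have H : \forall n \near \oo, 1 - eps <= u (p_ n) a /\ A n <= h^-1 + eps.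
  by apply: filterI; [exact: ua|exact: energy_limsup].
have [N _ /(_ N (leqnn N)) [h1 h2]] := H.
have := green_bound hend a (u_H10 N); rewrite -/g -/(A N) => h3.
have h4 : g * A N <= g * (h^-1 + eps) by rewrite ler_pM2l.
have eE : eps * (2 + g) = 1 - g / h by rewrite /eps divfK// gt_eqF// addr_gt0.
have e1 : eps <= 1.
  rewrite /eps ler_pdivrMr ?addr_gt0// mul1r.
  have : 0 < g / h by rewrite divr_gt0.
  lra.
have h5 : (1 - eps) ^+ 2 <= u (p_ N) a ^+ 2 by rewrite lerXn2r ?nnegrE//; lra.
rewrite mulrDr in h4; nra.
Qed.

End Concentration.

(** * Convergence in energy *)

Section Main.
Context {R : realType} {G : metric_graph R}.
Local Notation mu := (@lebesgue_measure R).
Hypothesis hend : V_end G != finset.set0.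

Lemma H1_norm_bound : exists2 K : R, 0 < K &
  forall v : point G -> R, H10 v -> H1_norm v ^+ 2 <= K * dirichlet v v.
Proof.
have [C C0 hC] := uniform_bound hend.
pose L := \sum_(e : edge G) len e.
have L0 : 0 <= L by apply: sumr_ge0 => e _; exact/ltW/len_gt0.
exists (1 + C * L); first by rewrite ltr_pwDl// mulr_ge0// ltW.
move=> v hv.
have gv e : square_integrable (len e) (grad v e) := H1_square_integrable e hv.1.
have rv e : square_integrable (len e) (restr v e) := (hv.1.2 e).1.
rewrite /H1_norm sqr_sqrtr; last first.
  apply: sumr_ge0 => e _; apply: Rintegral_ge0 => x _.
  by rewrite addr_ge0// sqr_ge0.
rewrite /graph_integral (eq_bigr (fun e =>
  \int[mu]_(x in `[0, len e]) (grad v e x * grad v e x) +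
  \int[mu]_(x in `[0, len e]) (restr v e x ^+ 2))); last first.
  move=> e _; rewrite -RintegralD//.
  - exact: square_integrable_mul.
  - exact: (rv e).2.
rewrite big_split/= -[X in X + _](dirichletE v v) mulrDl mul1r lerD2l.
rewrite -mulrA mulrCA mulrC /L mulr_sumr; apply: ler_sum => e _.
have -> : C * dirichlet v v * len e = \int[mu]_(x in `[0, len e]) (cst (C * dirichlet v v) x).
  by rewrite Rintegral_cst_itv ?subr0// ltW ?len_gt0.
apply: le_Rintegral => //; first exact: (rv e).2.
  exact/square_integrable_integrable/square_integrable_cst.
by move=> x _; exact: hC.
Qed.

(** The Poincare inequality bounds both the [H1] norm and the uniform norm by the
    Dirichlet energy. *)
Lemma dirichlet_cvg (v_ : nat -> point G -> R) (w : point G -> R) :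
  (forall n, H10 (v_ n)) -> H10 w ->
  dirichlet (fun x => v_ n x - w x) (fun x => v_ n x - w x) @[n --> \oo] --> (0 : R) ->
  cvg_H10 v_ w /\ cvg_uniformly v_ w.
Proof.
move=> hv hw D0.
have hd n : H10 (fun x : point G => v_ n x - w x).
  by have := H10D (-1) (hv n) hw; congr H10; apply/funext => x; rewrite mulN1r.
split.
  have [K K0 hK] := H1_norm_bound.
  split=> //; apply/cvgrPdist_lt => e e0.
  have d0 : 0 < e ^+ 2 / K by rewrite divr_gt0// exprn_gt0.
  move/cvgrPdist_lt : D0 => /(_ _ d0); apply: filterS => n.
  rewrite !sub0r !normrN (ger0_norm (dirichlet_ge0 _)) ger0_norm ?sqrtr_ge0// => H.
  have := hK _ (hd n).
  have : K * dirichlet (fun x => v_ n x - w x) (fun x => v_ n x - w x) < e ^+ 2.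
    by rewrite mulrC -ltr_pdivlMr.
  move=> H1 H2; have := le_lt_trans H2 H1.
  exact: sqr_lt.
have [C C0 hC] := uniform_bound hend.
move=> e e0.
have d0 : 0 < e ^+ 2 / C by rewrite divr_gt0// exprn_gt0.
move/cvgrPdist_lt : D0 => /(_ _ d0); apply: filterS => n.
rewrite !sub0r !normrN (ger0_norm (dirichlet_ge0 _)) => H x.
have := hC _ x (hd n).
have : C * dirichlet (fun x => v_ n x - w x) (fun x => v_ n x - w x) < e ^+ 2.
  by rewrite mulrC -ltr_pdivlMr.
move=> H1 H2; have := le_lt_trans H2 H1.
by rewrite -real_normK ?num_real//; exact: sqr_lt.
Qed.

End Main.

Theorem theorem1 (R : realType) (G : metric_graph R)
    (hint : V_int G != finset.set0) (hend : V_end G != finset.set0)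
    (u : R -> point G -> R)
    (hu : forall p : R, 1 < p -> least_energy_solution p (u p)) :
  green_max G `<=` ~` range (@Vtx R G) /\
  forall p_ : nat -> R, (forall n, 1 < p_ n) -> p_ n @[n --> \oo] --> +oo ->
    exists (k : nat -> nat) (a : point G),
      [/\ {homo k : m n / (m < n)%N},
          green_max G a,
          cvg_H10 (fun n => u (p_ (k n))) (fun x => green G x a / green G a a) &
          cvg_uniformly (fun n => u (p_ (k n)))
            (fun x => green G x a / green G a a)].
Proof.
split; first exact: green_max_not_vertex.
move=> p_ p1 poo.
have [kappa k0 peak] := near_peak hint hend hu.
have [e_ /choice[x_ ex]] := choice (fun n => peak _ (p1 n)).
have [k [e [x [khomo ek xl cx]]]] := subsequence_edge (fun n => (ex n).1).
have pk1 n : 1 < p_ (k n) by [].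
have pkoo : p_ (k n) @[n --> \oo] --> +oo.
  have kn n : (n <= k n)%N.
    by elim: n => // n /leq_ltn_trans; apply; exact: khomo.
  apply/cvgryPgt => B; have [N _ HN] := (cvgryPgt _).1 poo B.
  by exists N => // n /= Nn; apply: HN => /=; exact: leq_trans (kn n).
have ua := peak_limit hend hu pk1 pkoo k0 xl.
have {}ua : forall eps : R, 0 < eps ->
    \forall n \near \oo, 1 - eps <= u (p_ (k n)) (chart e x).
  apply: (ua (x_ \o k)) => //.
    by move=> n /=; have [] := ex (k n); rewrite ek.
  by move=> n /=; have [_] := ex (k n); rewrite ek.
set a := chart e x in ua.
have [amax ga0 ae] := peak_limit_max hend hu pk1 pkoo ua.
set g := green G a a in ga0 *.
have gn0 : g != 0 by rewrite gt_eqF.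
have hg : H10 (green G ^~ a) by exact: green_H10.
have hw : H10 (fun x => green G x a / g).
  by have := H10Z g^-1 hg; congr H10; apply/funext => y; rewrite mulrC.
have hu' n : H10 (u (p_ (k n))) by exact: (lane_emden_H10 (pk1 n) (hu _ (pk1 n)).1).
have DE n : dirichlet (fun x => u (p_ (k n)) x - green G x a / g)
    (fun x => u (p_ (k n)) x - green G x a / g) =
    dirichlet (u (p_ (k n))) (u (p_ (k n))) - 2 * u (p_ (k n)) a / g + g^-1.
  have := dirichletDD (- g^-1) (hu' n).1 hg.1.
  rewrite (_ : (fun x => u (p_ (k n)) x + - g^-1 * green G x a) =
    (fun x => u (p_ (k n)) x - green G x a / g)); last first.
    by apply/funext => y; rewrite mulNr [in LHS]mulrC.
  move=> ->; rewrite dirichletC green_reproducing// green_diag// -/g.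
  by field.
have [|cH cU] := dirichlet_cvg hend hu' hw.
  apply/cvgrPdist_le => eps eps0.
  have eps2 : 0 < eps / 2 by rewrite divr_gt0.
  have eg : 0 < eps * g / 4 by rewrite divr_gt0// mulr_gt0.
  near=> n; rewrite sub0r normrN ger0_norm ?dirichlet_ge0// DE.
  have h1 : dirichlet (u (p_ (k n))) (u (p_ (k n))) <= g^-1 + eps / 2.
    by near: n; exact: (energy_limsup hend hu pk1 pkoo).
  have h2 : 1 - eps * g / 4 <= u (p_ (k n)) a by near: n; exact: ua.
  have h3 : (1 - eps * g / 4) / g <= u (p_ (k n)) a / g.
    by rewrite ler_pM2r ?invr_gt0.
  have h4 : (1 - eps * g / 4) / g = g^-1 - eps / 4 by field.
  rewrite -mulrA; lra.
by exists k, a; split.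
Unshelve. all: by end_near. Qed.
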